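(* The satisfiability problem for Boolean-Goal Strategy Logic (SL[BG]) — deciding, given an SL[BG] sentence $\varphi$, whether some concurrent game structure $G$ satisfies $G\models\varphi$ — is highly undecidable; in particular it is $\Sigma^1_1$-hard.
   Context: Concurrent game structures (CGS) $G=(\mathrm{AP},\mathrm{Ag},\mathrm{Ac},\mathrm{St},\lambda,\tau,s_0)$: finite non-empty sets of atomic propositions and agents, countable non-empty sets of actions and states, initial state $s_0$, labeling $\lambda:\mathrm{St}\to2^{\mathrm{AP}}$, transition function $\tau:\mathrm{St}\times\mathrm{Ac}^{\mathrm{Ag}}\to\mathrm{St}$. Strategy Logic (SL) formulas: $\varphi::=p\mid\neg\varphi\mid\varphi\wedge\varphi\mid\varphi\vee\varphi\mid\mathsf{X}\varphi\mid\varphi\mathsf{U}\varphi\mid\varphi\mathsf{R}\varphi\mid\langle\langle x\rangle\rangle\varphi\mid[\![x]\!]\varphi\mid(a,x)\varphi$, where $\langle\langle x\rangle\rangle$ / $[\![x]\!]$ quantify existentially/universally over strategies (maps from finite histories of states to actions) assigned to variable $x$, $(a,x)$ binds agent $a$ to the strategy of $x$, and temporal operators are evaluated as in LTL along the unique play determined by the strategies of all agents; $G\models\varphi$ iff $\varphi$ holds at $s_0$ under the empty assignment. Free agents/variables: agents become free under temporal operators, $(a,x)$ removes a free agent $a$ and adds $x$, quantifiers remove their variable. A quantification prefix over a finite set $V$ of variables is a word over $\{\langle\langle x\rangle\rangle,[\![x]\!]:x\in V\}$ in which each variable of $V$ occurs exactly once; a binding prefix is a word over $\{(a,x)\}$ in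 which each agent occurs exactly once. SL[BG] formulas: $\varphi::=p\mid\neg\varphi\mid\varphi\wedge\varphi\mid\varphi\vee\varphi\mid\mathsf{X}\varphi\mid\varphi\mathsf{U}\varphi\mid\varphi\mathsf{R}\varphi\mid\wp\psi$ and $\psi::=\flat\varphi\mid\neg\psi\mid\psi\wedge\psi\mid\psi\vee\psi$, where $\flat$ ranges over binding prefixes and, in $\wp\psi$, $\wp$ is a quantification prefix over exactly the free variables of $\psi$. *)

(* Defs.v *)
From Stdlib Require Cantor.
From mathcomp Require Import all_boot.

Set Implicit Arguments.
Unset Strict Implicit.
Unset Printing Implicit Defensive.

(** * Concurrent game structures *)

Record cgs (AP Ag : finType) := Cgs {
  actions : countType;
  states : countType;
  action_nonempty : inhabited actions;
  label : states -> {set AP};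
  trans : states -> {ffun Ag -> actions} -> states;
  init : states
}.

(** * Strategy Logic *)

(* Strategy variables are natural numbers. *)
Inductive sl (AP Ag : Type) : Type :=
| Atom of AP
| Not of sl AP Ag
| And of sl AP Ag & sl AP Ag
| Or of sl AP Ag & sl AP Ag
| Next of sl AP Ag
| Until of sl AP Ag & sl AP Ag
| Release of sl AP Ag & sl AP Ag
| Exists of nat & sl AP Ag
| Forall of nat & sl AP Ag
| Bind of Ag & nat & sl AP Ag.

Arguments Atom {AP Ag}.

(* [inl a] is a free agent, [inr x] a free variable.  A binding [(a, x)] makes
   [x] free only when [a] is free in its scope. *)
Fixpoint sl_free (AP : Type) (Ag : finType) (phi : sl AP Ag) : seq (Ag + nat) :=
  match phi with
  | Atom _ => [::]
  | Not f => sl_free f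
  | And f g | Or f g => sl_free f ++ sl_free g
  | Next f => map inl (enum Ag) ++ sl_free f
  | Until f g | Release f g => map inl (enum Ag) ++ sl_free f ++ sl_free g
  | Exists x f | Forall x f => filter (predC1 (inr x)) (sl_free f)
  | Bind a x f =>
      if inl a \in sl_free f then inr x :: filter (predC1 (inl a)) (sl_free f)
      else sl_free f
  end.

Definition sentence (AP : Type) (Ag : finType) (phi : sl AP Ag) : Prop :=
  sl_free phi = [::].

Section Semantics.
Variables (AP Ag : finType) (G : cgs AP Ag).

(* Histories are nonempty sequences of states, oldest first, that follow the
   transition function.  Strategies are taken total on all sequences: only
   their values on histories are ever used. *)
Definition strategy := seq (states G) -> actions G.

Definition assignment := (Ag + nat)%type -> option strategy.

Definition no_assignment : assignment := fun=> None.

Fixpoint history (sg : Ag -> strategy) (s : states G) (n : nat) : seq (states G) :=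
  if n is m.+1 then
    let h := history sg s m in
    rcons h (trans (last s h) [ffun a => sg a h])
  else [:: s].

Definition play (sg : Ag -> strategy) (s : states G) (n : nat) : states G :=
  last s (history sg s n).

Definition profile_of (chi : assignment) (sg : Ag -> strategy) : Prop :=
  forall a, chi (inl a) = Some (sg a).

(* When a play has moved through the states [h], every assigned strategy is
   replaced by what it prescribes after [h]. *)
Definition translate (chi : assignment) (h : seq (states G)) : assignment :=
  fun v => omap (fun (f : strategy) h' => f (h ++ h')) (chi v).

Definition asg_at (chi : assignment) (sg : Ag -> strategy) (s : states G)
    (i : nat) : assignment :=
  translate chi (mkseq (play sg s) i).

(* Meaningful when [chi] is defined on all of [sl_free phi]; in particular, the
   profile [sg] in the temporal cases then exists and is unique. *)
Fixpoint sat (phi : sl AP Ag) (chi : assignment) (s : states G) : Prop :=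
  match phi with
  | Atom p => p \in label s
  | Not f => ~ sat f chi s
  | And f g => sat f chi s /\ sat g chi s
  | Or f g => sat f chi s \/ sat g chi s
  | Next f =>
      exists2 sg, profile_of chi sg & sat f (asg_at chi sg s 1) (play sg s 1)
  | Until f g =>
      exists2 sg, profile_of chi sg &
      exists2 i, sat g (asg_at chi sg s i) (play sg s i) &
        forall j, j < i -> sat f (asg_at chi sg s j) (play sg s j)
  | Release f g =>
      exists2 sg, profile_of chi sg &
      forall i, sat g (asg_at chi sg s i) (play sg s i) \/
        exists2 j, j < i & sat f (asg_at chi sg s j) (play sg s j)
  | Exists x f => exists st : strategy, sat f [eta chi with inr x |-> Some st] s
  | Forall x f => forall st : strategy, sat f [eta chi with inr x |-> Some st] s
  | Bind a x f => sat f [eta chi with inl a |-> chi (inr x)] s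
  end.

Definition models (phi : sl AP Ag) : Prop := sat phi no_assignment (init G).

End Semantics.

(** * The Boolean-goal fragment *)

(* In a quantification prefix, [(true, x)] is the existential and [(false, x)]
   the universal quantifier on [x]. *)
Definition quantify (AP Ag : Type) (wp : seq (bool * nat)) (phi : sl AP Ag) :
    sl AP Ag :=
  foldr (fun q f => if q.1 then Exists q.2 f else Forall q.2 f) phi wp.

Definition bind_all (AP Ag : Type) (b : seq (Ag * nat)) (phi : sl AP Ag) :
    sl AP Ag :=
  foldr (fun ax f => Bind ax.1 ax.2 f) phi b.

Definition binding_prefix (Ag : finType) (b : seq (Ag * nat)) : Prop :=
  perm_eq (unzip1 b) (enum Ag).

Definition quantification_prefix (AP : Type) (Ag : finType)
    (wp : seq (bool * nat)) (psi : sl AP Ag) : Prop :=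
  uniq (unzip2 wp) /\ forall x, (x \in unzip2 wp) = (inr x \in sl_free psi).

Inductive slbg (AP : Type) (Ag : finType) : sl AP Ag -> Prop :=
| bg_atom p : slbg (Atom p)
| bg_not f : slbg f -> slbg (Not f)
| bg_and f g : slbg f -> slbg g -> slbg (And f g)
| bg_or f g : slbg f -> slbg g -> slbg (Or f g)
| bg_next f : slbg f -> slbg (Next f)
| bg_until f g : slbg f -> slbg g -> slbg (Until f g)
| bg_release f g : slbg f -> slbg g -> slbg (Release f g)
| bg_quantify wp psi :
    quantification_prefix wp psi -> bgoal psi -> slbg (quantify wp psi)
with bgoal (AP : Type) (Ag : finType) : sl AP Ag -> Prop :=
| bgoal_bind b f : binding_prefix b -> slbg f -> bgoal (bind_all b f)
| bgoal_not f : bgoal f -> bgoal (Not f)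
| bgoal_and f g : bgoal f -> bgoal g -> bgoal (And f g)
| bgoal_or f g : bgoal f -> bgoal g -> bgoal (Or f g).

(** * The satisfiability problem *)

(* The finite nonempty sets of propositions and agents over which a sentence is
   written are part of the sentence, and are taken to be initial segments of
   the natural numbers. *)
Record slbg_sentence := SlbgSentence {
  ap_pred : nat;
  ag_pred : nat;
  formula : sl 'I_ap_pred.+1 'I_ag_pred.+1;
  formula_slbg : slbg formula;
  formula_sentence : sentence formula
}.

Definition satisfiable (phi : slbg_sentence) : Prop :=
  exists G : cgs 'I_(ap_pred phi).+1 'I_(ag_pred phi).+1,
    models G (formula phi).

Definition npair (x y : nat) : nat := Cantor.to_nat (x, y).

Fixpoint sl_code (m n : nat) (phi : sl 'I_m 'I_n) : nat :=
  match phi with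
  | Atom p => npair 0 p
  | Not f => npair 1 (sl_code f)
  | And f g => npair 2 (npair (sl_code f) (sl_code g))
  | Or f g => npair 3 (npair (sl_code f) (sl_code g))
  | Next f => npair 4 (sl_code f)
  | Until f g => npair 5 (npair (sl_code f) (sl_code g))
  | Release f g => npair 6 (npair (sl_code f) (sl_code g))
  | Exists x f => npair 7 (npair x (sl_code f))
  | Forall x f => npair 8 (npair x (sl_code f))
  | Bind a x f => npair 9 (npair a (npair x (sl_code f)))
  end.

Definition slbg_code (phi : slbg_sentence) : nat :=
  npair (ap_pred phi) (npair (ag_pred phi) (sl_code (formula phi))).

(** * Computable functions: the partial recursive functions *)

Inductive recfun : nat -> Type :=
| RZero k : recfun k
| RSucc : recfun 1
| RProj k of 'I_k : recfun k
| RComp k m of recfun k & ('I_k -> recfun m) : recfun m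
| RPrec k of recfun k & recfun k.+2 : recfun k.+1
| RMin k of recfun k.+1 : recfun k.

(* [reval c v y]: the function with index [c] is defined at [v], with value
   [y]. *)
Fixpoint reval (k : nat) (c : recfun k) : k.-tuple nat -> nat -> Prop :=
  match c in recfun k return k.-tuple nat -> nat -> Prop with
  | RZero _ => fun _ y => y = 0
  | RSucc => fun v y => y = (thead v).+1
  | RProj _ i => fun v y => y = tnth v i
  | RComp k _ f g => fun v y =>
      exists2 w : k.-tuple nat,
        forall i, reval (g i) v (tnth w i) & reval f w y
  | RPrec k f g => fun v =>
      let w := [tuple of behead v] : k.-tuple nat in
      (fix prec (n : nat) : nat -> Prop :=
         if n is m.+1 then
           fun y => exists2 z, prec m z & reval g [tuple of m :: z :: w] y
         else reval f w) (thead v)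
  | RMin _ f => fun v y =>
      reval f [tuple of y :: v] 0 /\
      forall z, z < y -> exists u, reval f [tuple of z :: v] u.+1
  end.

Definition computable (f : nat -> nat) : Prop :=
  exists c : recfun 1, forall n, reval c [tuple n] (f n).

(** * Sigma^1_1 sets of natural numbers *)

(* Number variables are de Bruijn indices. *)
Inductive aterm : Type :=
| AVar of nat
| AZero
| ASucc of aterm
| AAdd of aterm & aterm
| AMul of aterm & aterm.

(* Arithmetical formulas with [k] set variables: no quantification on sets. *)
Inductive aform (k : nat) : Type :=
| AEq of aterm & aterm
| AMem of aterm & 'I_k
| ANot of aform k
| AAnd of aform k & aform k
| AOr of aform k & aform k
| AEx of aform k
| AAll of aform k.

Fixpoint aeval (e : seq nat) (t : aterm) : nat :=
  match t with
  | AVar i => nth 0 e i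
  | AZero => 0
  | ASucc t => (aeval e t).+1
  | AAdd t u => aeval e t + aeval e u
  | AMul t u => aeval e t * aeval e u
  end.

Fixpoint aholds (k : nat) (X : 'I_k -> nat -> Prop) (e : seq nat)
    (phi : aform k) : Prop :=
  match phi with
  | AEq t u => aeval e t = aeval e u
  | AMem t i => X i (aeval e t)
  | ANot f => ~ aholds X e f
  | AAnd f g => aholds X e f /\ aholds X e g
  | AOr f g => aholds X e f \/ aholds X e g
  | AEx f => exists n, aholds X (n :: e) f
  | AAll f => forall n, aholds X (n :: e) f
  end.

Definition sigma11 (A : nat -> Prop) : Prop :=
  exists k (phi : aform k),
    forall n, A n <-> exists X : 'I_k -> nat -> Prop, aholds X [:: n] phi.

(* Hardness under computable many-one reductions of the problem of deciding [P]
   on the instances [I], which are presented to algorithms through [code]. *)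
Definition sigma11_hard (I : Type) (code : I -> nat) (P : I -> Prop) : Prop :=
  forall A, sigma11 A ->
    exists2 r : nat -> I,
      computable (fun n => code (r n)) & forall n, A n <-> P (r n).

(* Main.v *)
Require Import Defs.
From mathcomp Require Import all_boot.
From mathcomp Require Import boolp.

(* On one-step goals, quantified strategies range over the actions available in
   the initial state, and the labels of its successors interpret relation
   symbols of arity up to four on actions; since a model is guessed, this much
   is first-order logic with existential second-order quantifiers over a
   countable domain.  It remains to make the domain a copy of the natural
   numbers.  A second step gives set quantification: agents 0, 1, 2 first play
   the number [x], then agent 3 decides whether [x] belongs to its set.  For
   these sets to be arbitrary, the state reached after [x] must not depend on
   the first action of agent 3 and must determine [x].  Both can be forced,
   because strategies see states: two profiles lead to the same state iff no
   agent that controls the next label can react differently to them, and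
   control of the next label is expressed by a nested sentence.  Full induction
   is then a sentence, and an arithmetical formula with guessed sets is
   translated literally and prenexed into a Boolean goal.  The input [n] occurs
   only in a chain of [n] explicit successor steps, so that the code of the
   sentence is primitive recursive in [n]. *)

Set Implicit Arguments.
Unset Strict Implicit.
Unset Printing Implicit Defensive.

(** * Satisfaction and free variables *)

Section Satisfaction.
Variables (AP Ag : finType) (G : cgs AP Ag).
Implicit Types (phi psi : sl AP Ag) (chi : assignment G) (s : states G).

Lemma sat_free phi chi chi' s :
  {in sl_free phi, chi =1 chi'} -> sat phi chi s -> sat phi chi' s.
Proof.
have agents c c' (l : seq (Ag + nat)) sg :
    {in map inl (enum Ag) ++ l, c =1 c'} -> @profile_of _ _ G c sg -> profile_of c' sg.
  by move=> cc' pc a; rewrite -cc' // mem_cat map_f // mem_enum.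
have later c c' (l : seq (Ag + nat)) sg st i :
    {in l, c =1 c'} -> {in l, @asg_at _ _ G c sg st i =1 asg_at c' sg st i}.
  by move=> cc' w lw; rewrite /asg_at /translate cc'.
have sub1 (l l1 : seq (Ag + nat)) c c' : {subset l1 <= l} ->
    {in l, c =1 c'} -> {in l1, c =1 (c' : assignment G)}.
  by move=> sl cc' w /sl /cc'.
have inl1 (l1 l2 : seq (Ag + nat)) : {subset l1 <= l1 ++ l2}.
  by move=> w lw; rewrite mem_cat lw.
have inl2 (l1 l2 : seq (Ag + nat)) : {subset l2 <= l1 ++ l2}.
  by move=> w lw; rewrite mem_cat lw orbT.
elim: phi chi chi' s => //=.
- by move=> f IH c c' s cc' Hf /(IH _ c) Hc; apply: Hf; apply: Hc => w /cc'.
- move=> f IHf g IHg c c' s cc' [Hf Hg]; split.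
    by apply: IHf Hf; apply: sub1 cc' => //; apply: inl1.
  by apply: IHg Hg; apply: sub1 cc' => //; apply: inl2.
- move=> f IHf g IHg c c' s cc' [Hf|Hg]; [left|right].
    by apply: IHf Hf; apply: sub1 cc' => //; apply: inl1.
  by apply: IHg Hg; apply: sub1 cc' => //; apply: inl2.
- move=> f IHf c c' s cc' [sg pc Hf]; exists sg; first exact: agents cc' pc.
  by apply: IHf Hf; apply: later; apply: sub1 cc' => //; apply: inl2.
- move=> f IHf g IHg c c' s cc' [sg pc [i Hg Hf]].
  have ccf : {in sl_free f, c =1 c'}.
    by apply: sub1 cc' => // w Hw; apply/inl2/inl1.
  have ccg : {in sl_free g, c =1 c'}.
    by apply: sub1 cc' => // w Hw; apply/inl2/inl2.
  exists sg; first exact: agents cc' pc.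
  exists i; first by apply: IHg Hg; apply: later.
  by move=> j /Hf; apply: IHf; apply: later.
- move=> f IHf g IHg c c' s cc' [sg pc Hfg].
  have ccf : {in sl_free f, c =1 c'}.
    by apply: sub1 cc' => // w Hw; apply/inl2/inl1.
  have ccg : {in sl_free g, c =1 c'}.
    by apply: sub1 cc' => // w Hw; apply/inl2/inl2.
  exists sg; first exact: agents cc' pc.
  move=> i; case: (Hfg i) => [Hg|[j ji Hf]]; [left|right].
    by apply: IHg Hg; apply: later.
  by exists j => //; apply: IHf Hf; apply: later.
- move=> x f IH c c' s cc' [st Hf]; exists st; apply: IH Hf => w fw /=.
  by case: eqP => // /eqP wx; apply: cc'; rewrite mem_filter /= wx.
- move=> x f IH c c' s cc' Hf st; apply: IH (Hf st) => w fw /=.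
  by case: eqP => // /eqP wx; apply: cc'; rewrite mem_filter /= wx.
- move=> a x f IH c c' s cc'; apply: IH => w fw /=.
  case: eqP => [wa|/eqP wa]; move: cc'.
    by rewrite -wa fw => cc'; apply: cc'; rewrite mem_head.
  case: ifP => _ cc'; apply: cc' => //.
  by rewrite inE mem_filter /= wa fw orbT.
Qed.

Lemma sat_ext phi chi chi' s :
  {in sl_free phi, chi =1 chi'} -> sat phi chi s <-> sat phi chi' s.
Proof.
by move=> cc'; split; apply: sat_free => // w /cc'.
Qed.

(** The assignment seen by a goal once its binding prefix has bound every agent. Variables are
    dropped because the goals considered have none free. *)
Definition profile_asg (sg : Ag -> strategy G) : assignment G :=
  fun w => if w is inl a then Some (sg a) else None.

(** Bindings read variables and write agents, so none disturbs another and every variable is read in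
    the original [chi]. *)
Lemma sat_bind_all (l : seq Ag) (sigma : Ag -> nat) phi chi s :
  sat (bind_all [seq (a, sigma a) | a <- l] phi) chi s <->
  sat phi (fun w => if w is inl a then
                      if a \in l then chi (inr (sigma a)) else chi w
                    else chi w) s.
Proof.
elim: l chi => [|a l IH] chi /=; first by apply: sat_ext => -[].
apply: iff_trans (IH _) _; apply: sat_ext => -[b|x] _ //=.
rewrite inE; case: (eqVneq b a) => [->|ba] /=; first by rewrite eqxx if_same.
by case: ifP => // _; case: eqP => // -[/eqP]; rewrite (negbTE ba).
Qed.

Lemma sat_next f (sg : Ag -> strategy G) s :
  sat (Next f) (profile_asg sg) s <->
  sat f (translate (profile_asg sg) [:: s]) (trans s [ffun a => sg a [:: s]]).
Proof.
split=> /= [[sg' psg'] | H]; last by exists sg.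
have -> : sg' = sg.
  by apply/funext => a; move: (psg' a) => /= [].
by [].
Qed.

Lemma sat_quantify_iff wp phi psi chi s :
  (forall chi, sat phi chi s <-> sat psi chi s) ->
  sat (quantify wp phi) chi s <-> sat (quantify wp psi) chi s.
Proof.
move=> E; elim: wp chi => [|[[] x] wp IH] chi //=.
  by split=> -[st /IH Hst]; exists st.
by split=> H st; apply/IH.
Qed.

Lemma sat_quantify_not wp phi chi s :
  sat (quantify [seq (~~ q.1, q.2) | q <- wp] (Not phi)) chi s <->
  ~ sat (quantify wp phi) chi s.
Proof.
elim: wp chi => [|[[] x] wp IH] chi //=.
  by split=> [H [st] | H st]; [apply/IH | apply/IH => H'; apply: H; exists st].
split=> [[st /IH H] H' //| /existsNP[st Hst]].
by exists st; apply/IH.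
Qed.

(** Some strategy must exist: [phi] is read off a universal quantifier only through an instance. *)
Lemma sat_quantify_andr wp phi psi chi s : inhabited (strategy G) ->
  (forall x, x \in unzip2 wp -> inr x \notin sl_free phi) ->
  sat (quantify wp (And phi psi)) chi s <->
  sat phi chi s /\ sat (quantify wp psi) chi s.
Proof.
move=> [st0]; elim: wp chi => [|[b x] wp IH] chi //= Hfree.
have Hx st : sat phi [eta chi with inr x |-> Some st] s <-> sat phi chi s.
  apply: sat_ext => w fw /=; case: eqP => // wx.
  by move: (Hfree x); rewrite inE eqxx -wx fw => /(_ isT).
have {}IH st : sat (quantify wp (And phi psi)) [eta chi with inr x |-> Some st] s <->
    sat phi chi s /\ sat (quantify wp psi) [eta chi with inr x |-> Some st] s.
  apply: iff_trans (IH _ _) _; last by split=> -[/Hx].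
  by move=> y wy; apply: Hfree; rewrite inE wy orbT.
case: b {Hfree}.
  split=> [[st /IH[H1 H2]] | [H1 [st H2]]]; first by split=> //; exists st.
  by exists st; apply/IH.
split=> [H | [H1 H2] st]; last by apply/IH.
by split=> [|st]; [case/IH: (H st0) | case/IH: (H st)].
Qed.

End Satisfaction.

(** * Prenexing first-order combinations of goals *)

Section FreeVariables.
Variables (AP Ag : finType).
Implicit Types (phi : sl AP Ag).

Lemma mem_free_quantify wp phi w :
  (w \in sl_free (quantify wp phi)) =
  (w \notin [seq inr x | x <- unzip2 wp]) && (w \in sl_free phi).
Proof.
elim: wp => [|[b x] wp IH] //=.
by case: b; rewrite /= mem_filter IH inE negb_or /= andbA.
Qed.

Lemma mem_free_bind_all (l : seq Ag) (sigma : Ag -> nat) phi w : uniq l ->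
  (w \in sl_free (bind_all [seq (a, sigma a) | a <- l] phi)) =
  match w with
  | inl a => (a \notin l) && (w \in sl_free phi)
  | inr x => (w \in sl_free phi) ||
             has (fun a => (inl a \in sl_free phi) && (sigma a == x)) l
  end.
Proof.
elim: l w => [|a l IH] w /=; first by case: w => // x; rewrite orbF.
case/andP=> al /IH{}IH; rewrite (IH (inl a)) (negbTE al) /=.
case: ifP => Ha; last first.
  case: w => [b|x]; rewrite IH // inE negb_or.
  by case: eqP => [->|] //; rewrite Ha al.
rewrite inE mem_filter; case: w => [b|x]; rewrite IH /= ?inE ?negb_or ?andbA //.
by rewrite orbCA; congr orb; rewrite eq_sym.
Qed.

End FreeVariables.

(* De Bruijn indices. *)
Inductive fo (A : Type) : Type :=
| Goal of A
| FNot of fo A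
| FAnd of fo A & fo A
| FImp of fo A & fo A
| FEx of fo A
| FAll of fo A.

Definition FIff A (f g : fo A) := FAnd (FImp f g) (FImp g f).

Section Prenex.
Variables (m n : nat).
Notation AP := 'I_m.+1.
Notation Ag := 'I_n.+1.

Definition path_formula (g : sl AP Ag) : Prop :=
  slbg g /\ forall x, inr x \notin sl_free g.

(* In the goal of an atom [t], agent [a] is bound to the variable
   [nth 0 (vars t) a]. *)
Variables (A : Type) (goal : A -> sl AP Ag) (vars : A -> seq nat).
(** Atoms stay abstract because prenexing is carried out at two levels: for the nested sentence
    [control], and for formulas that have this sentence inside an atom. *)
Variable asem : forall G : cgs AP Ag, A -> states G -> (nat -> strategy G) -> Prop.
Hypothesis goal_path : forall t, path_formula (goal t).
Hypothesis asemP : forall (G : cgs AP Ag) t (s : states G) v,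
  sat (goal t) (profile_asg (fun a : Ag => v (nth 0 (vars t) a))) s <->
  asem t s v.
Notation fo := (fo A).

(** The condition [0 < d] covers agents past the end of [vars t], which [nth] binds to index 0. *)
Fixpoint scope (d : nat) (f : fo) : bool :=
  match f with
  | Goal t => (0 < d) && all (fun x => x < d) (vars t)
  | FNot f => scope d f
  | FEx f | FAll f => scope d.+1 f
  | FAnd f g | FImp f g => scope d f && scope d g
  end.

Definition scons (T : Type) (x : T) (v : nat -> T) (i : nat) : T :=
  if i is j.+1 then v j else x.

Fixpoint fsat (G : cgs AP Ag) (f : fo) (s : states G) (v : nat -> strategy G) :
    Prop :=
  match f with
  | Goal t => asem t s v
  | FNot f => ~ fsat f s v
  | FAnd f g => fsat f s v /\ fsat g s v
  | FImp f g => fsat f s v -> fsat g s v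
  | FEx f => exists st, fsat f s (scons st v)
  | FAll f => forall st, fsat f s (scons st v)
  end.

Fixpoint quantifiers (f : fo) : nat :=
  match f with
  | Goal _ => 0
  | FNot f => quantifiers f
  | FEx f | FAll f => (quantifiers f).+1
  | FAnd f g | FImp f g => quantifiers f + quantifiers g
  end.

Definition dual (wp : seq (bool * nat)) := [seq (~~ q.1, q.2) | q <- wp].

(** Quantifiers receive consecutive names from [k] on, so the two sides of a connective never share
    a bound name. An implication is read as the negation of [f] and not [g], which dualizes the
    prefix of [f] only. *)
Fixpoint prenex_prefix (k : nat) (f : fo) : seq (bool * nat) :=
  match f with
  | Goal _ => [::]
  | FNot f => dual (prenex_prefix k f)
  | FAnd f g => prenex_prefix k f ++ prenex_prefix (k + quantifiers f) g
  | FImp f g => dual (prenex_prefix k f) ++ prenex_prefix (k + quantifiers f) g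
  | FEx f => (true, k) :: prenex_prefix k.+1 f
  | FAll f => (false, k) :: prenex_prefix k.+1 f
  end.

Definition bind_profile (sigma : Ag -> nat) (g : sl AP Ag) :=
  bind_all [seq (a, sigma a) | a <- enum Ag] g.

Fixpoint prenex_matrix (rho : nat -> nat) (k : nat) (f : fo) : sl AP Ag :=
  match f with
  | Goal t => bind_profile (fun a => rho (nth 0 (vars t) a)) (goal t)
  | FNot f => Not (prenex_matrix rho k f)
  | FAnd f g =>
      And (prenex_matrix rho k f) (prenex_matrix rho (k + quantifiers f) g)
  | FImp f g =>
      Not (And (prenex_matrix rho k f)
               (Not (prenex_matrix rho (k + quantifiers f) g)))
  | FEx f | FAll f => prenex_matrix (scons k rho) k.+1 f
  end.

Lemma dualK : involutive dual.
Proof. by elim=> [|[b x] wp IH] //=; rewrite negbK IH. Qed.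

Lemma unzip2_dual wp : unzip2 (dual wp) = unzip2 wp.
Proof. by rewrite /unzip2 -map_comp. Qed.

Lemma unzip2_prenex_prefix k f :
  unzip2 (prenex_prefix k f) = iota k (quantifiers f).
Proof.
elim: f k => [t|f IH|f IHf g IHg|f IHf g IHg|f IH|f IH] k //=; rewrite ?IH //.
- by rewrite unzip2_dual.
- by rewrite iotaD -IHf -IHg -map_cat.
- by rewrite iotaD -IHf -IHg -(unzip2_dual (prenex_prefix k f)) -map_cat.
Qed.

Lemma nth_scope d b (a : Ag) : 0 < d -> all (fun x => x < d) b -> nth 0 b a < d.
Proof.
move=> d0 /all_nthP Hb; case: (ltnP a (size b)) => [/Hb|] //.
by move=> ba; rewrite nth_default.
Qed.

Lemma scons_bound d rho k : (forall i, i < d -> rho i < k) ->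
  forall i, i < d.+1 -> scons k rho i < k.+1.
Proof. by move=> H [|i] //= /H /ltnW. Qed.

(** A name is inherited through [rho] or lies in the interval reserved for [f]; this gives the
    freshness conditions for moving quantifiers past conjuncts. *)
Lemma free_prenex_matrix d rho k f w : scope d f ->
    (forall i, i < d -> rho i < k) ->
    w \in sl_free (prenex_matrix rho k f) ->
  exists2 x, w = inr x &
    (exists2 i, i < d & x = rho i) \/ k <= x < k + quantifiers f.
Proof.
elim: f d rho k => [t|f IH|f IHf g IHg|f IHf g IHg|f IH|f IH] d rho k /=.
- case/andP=> d0 db _; have [_ Hg] := goal_path t; rewrite mem_free_bind_all ?enum_uniq //.
  case: w => [a|x]; first by rewrite mem_enum.
  rewrite (negbTE (Hg x)) => /hasP[a _ /andP[_ /eqP <-]].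
  by eexists=> //; left; eexists; last reflexivity; apply: nth_scope.
- exact: IH.
- case/andP=> sf sg Hr; rewrite mem_cat => /orP[].
    case/(IHf _ _ _ sf Hr) => x -> [Hx|/andP[kx xk]]; exists x => //.
      by left.
    by right; rewrite kx (leq_trans xk) // leq_add2l leq_addr.
  have Hr' i : i < d -> rho i < k + quantifiers f by move/Hr/leq_trans; apply; apply: leq_addr.
  case/(IHg _ _ _ sg Hr') => x -> [Hx|/andP[kx xk]]; exists x => //.
    by left.
  by right; rewrite (leq_trans (leq_addr _ _) kx) addnA.
- case/andP=> sf sg Hr; rewrite mem_cat => /orP[].
    case/(IHf _ _ _ sf Hr) => x -> [Hx|/andP[kx xk]]; exists x => //.
      by left.
    by right; rewrite kx (leq_trans xk) // leq_add2l leq_addr.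
  have Hr' i : i < d -> rho i < k + quantifiers f by move/Hr/leq_trans; apply; apply: leq_addr.
  case/(IHg _ _ _ sg Hr') => x -> [Hx|/andP[kx xk]]; exists x => //.
    by left.
  by right; rewrite (leq_trans (leq_addr _ _) kx) addnA.
- move=> sf /scons_bound Hr /(IH _ _ _ sf Hr)[x -> [[[|i] id_ ->]|]].
  + by exists k => //; right; rewrite leqnn addnS ltnS leq_addr.
  + by exists (rho i) => //; left; exists i.
  + by case/andP=> kx xk; exists x => //; right; rewrite (ltnW kx) addnS.
- move=> sf /scons_bound Hr /(IH _ _ _ sf Hr)[x -> [[[|i] id_ ->]|]].
  + by exists k => //; right; rewrite leqnn addnS ltnS leq_addr.
  + by exists (rho i) => //; left; exists i.
  + by case/andP=> kx xk; exists x => //; right; rewrite (ltnW kx) addnS.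
Qed.

Lemma sat_bind_profile (G : cgs AP Ag) sigma g chi (s : states G)
    (sg : Ag -> strategy G) :
  (forall x, inr x \notin sl_free g) ->
  (forall a, chi (inr (sigma a)) = Some (sg a)) ->
  sat (bind_profile sigma g) chi s <-> sat g (profile_asg sg) s.
Proof.
move=> Hg Hc; apply: iff_trans (sat_bind_all _ _ _ _ _) _.
apply: sat_ext => -[a|x] /=; first by rewrite mem_enum Hc.
by rewrite (negbTE (Hg x)).
Qed.

Lemma sat_prenex_and (G : cgs AP Ag) w1 w2 (p1 p2 : sl AP Ag) chi (s : states G) :
  (forall x, x \in unzip2 w2 -> inr x \notin sl_free p1) ->
  (forall x, x \in unzip2 w1 -> x \notin unzip2 w2 -> inr x \notin sl_free p2) ->
  sat (quantify (w1 ++ w2) (And p1 p2)) chi s <->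
  sat (quantify w1 p1) chi s /\ sat (quantify w2 p2) chi s.
Proof.
move=> H1 H2; have [act] := action_nonempty G.
have ne : inhabited (strategy G) by exists; exact: (fun=> act).
rewrite /quantify foldr_cat -!/(quantify _ _).
(* First [p1] is taken out of the scope of [w2]; then, with the conjuncts swapped, [quantify w2 p2]
   is taken out of the scope of [w1]. *)
apply: iff_trans (_ : sat (quantify w1 (And (quantify w2 p2) p1)) chi s <-> _).
  apply: sat_quantify_iff => c; apply: iff_trans (sat_quantify_andr _ _ _ _ _) _ => //=.
  by split=> -[].
apply: iff_trans (sat_quantify_andr _ _ _ _ _) _ => //; last by split=> -[].
move=> x x1; rewrite mem_free_quantify negb_and negbK mem_map; last by move=> ? ? [].
by case: (boolP (x \in _)) => //= x2; apply: H2.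
Qed.

Lemma sat_prenex (G : cgs AP Ag) f d rho k chi (s : states G) v :
    scope d f -> (forall i, i < d -> rho i < k) ->
    (forall i, i < d -> chi (inr (rho i)) = Some (v i)) ->
  sat (quantify (prenex_prefix k f) (prenex_matrix rho k f)) chi s <->
  fsat f s v.
Proof.
have up e r l j : (forall i, i < e -> r i < l) -> forall i, i < e -> r i < l + j.
  by move=> H i /H /leq_trans; apply; apply: leq_addr.
have disj1 f1 e r l x : scope e f1 -> (forall i, i < e -> r i < l) ->
    l + quantifiers f1 <= x -> inr x \notin sl_free (prenex_matrix r l f1).
  move=> sf Hr lx; apply/negP => /(free_prenex_matrix sf Hr) [_ [<-] []].
    by case=> i /Hr + xr; rewrite -xr ltnNge (leq_trans (leq_addr _ _) lx).
  by rewrite ltnNge lx andbF.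
have disj2 f1 e r l x : scope e f1 -> (forall i, i < e -> r i < l) ->
    (forall i, i < e -> r i != x) ->
    x \notin iota l (quantifiers f1) -> inr x \notin sl_free (prenex_matrix r l f1).
  move=> sf Hr rx lx; apply/negP => /(free_prenex_matrix sf Hr) [_ [<-] []].
    by case=> i /rx + xr; rewrite xr eqxx.
  by rewrite -mem_iota (negbTE lx).
elim: f d rho k chi v => [t|f IH|f IHf g IHg|f IHf g IHg|f IH|f IH] d rho k chi v /=.
- case/andP=> d0 db Hr Hv; have [_ Hg] := goal_path t; apply: iff_trans (asemP _ _ _).
  apply: sat_bind_profile => // a.
  exact/Hv/nth_scope.
- move=> sf Hr Hv; apply: iff_trans (sat_quantify_not _ _ _ _) _.
  by have H := IH _ _ _ _ _ sf Hr Hv; split=> + /H.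
- case/andP=> sf sg Hr Hv.
  have Hf := IHf _ _ _ _ _ sf Hr Hv.
  have Hg := IHg _ _ _ _ _ sg (up _ _ _ (quantifiers f) Hr) Hv.
  apply: iff_trans (sat_prenex_and _ _ _ _) _.
  + move=> x; rewrite unzip2_prenex_prefix mem_iota => /andP[+ _].
    exact: (disj1 _ d).
  + move=> x; rewrite !unzip2_prenex_prefix => x1; apply: (disj2 _ d) => //; first exact: up.
    move=> i /Hr; apply: contraTneq => ->; move: x1; rewrite mem_iota => /andP[+ _].
    by rewrite -leqNgt.
  + by rewrite (propext Hf) (propext Hg).
- case/andP=> sf sg Hr Hv.
  have Hf := IHf _ _ _ _ _ sf Hr Hv.
  have Hg := IHg _ _ _ _ _ sg (up _ _ _ (quantifiers f) Hr) Hv.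
  (* The prefix becomes the dual of the one for [f] and not [g], so the outer negation moves to the
     front and the conjunction argument applies. *)
  rewrite -[prenex_prefix (k + _) g]dualK -[dual _ ++ dual _]map_cat.
  apply: iff_trans (sat_quantify_not _ _ _ _) _.
  have E : sat (quantify (prenex_prefix k f ++ dual (prenex_prefix (k + quantifiers f) g))
      (And (prenex_matrix rho k f) (Not (prenex_matrix rho (k + quantifiers f) g)))) chi s
      <-> fsat f s v /\ ~ fsat g s v.
    apply: iff_trans (sat_prenex_and _ _ _ _) _.
    + move=> x; rewrite unzip2_dual unzip2_prenex_prefix mem_iota => /andP[+ _].
      exact: (disj1 _ d).
    + move=> x; rewrite unzip2_dual !unzip2_prenex_prefix => x1.
      apply: (disj2 _ d) => //; first exact: up.
      move=> i /Hr; apply: contraTneq => ->; move: x1; rewrite mem_iota => /andP[+ _].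
      by rewrite -leqNgt.
    + split=> -[H1 H2]; split; try exact/Hf.
        by move/sat_quantify_not: H2 => + /Hg.
      by apply/sat_quantify_not => /Hg.
  split=> [H Hff|H /E[/H]] //; apply: contrapT => Hgg.
  by apply: H; apply/E.
- move=> sf Hr Hv.
  have H st := IH _ _ _ [eta chi with inr k |-> Some st] (scons st v) sf (scons_bound Hr).
  split=> -[st Hst]; exists st; [apply/(H st)|apply/H] => // {Hst} -[|i] //=.
  + by rewrite eqxx.
  + by move=> id_; case: eqP => [[e]|_]; [have := Hr i id_; rewrite e ltnn | apply: Hv].
  + by rewrite eqxx.
  + by move=> id_; case: eqP => [[e]|_]; [have := Hr i id_; rewrite e ltnn | apply: Hv].
- move=> sf Hr Hv.
  have H st := IH _ _ _ [eta chi with inr k |-> Some st] (scons st v) sf (scons_bound Hr).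
  split=> Hst st; [apply/(H st)|apply/H] => // {Hst} -[|i] //=.
  + by rewrite eqxx.
  + by move=> id_; case: eqP => [[e]|_]; [have := Hr i id_; rewrite e ltnn | apply: Hv].
  + by rewrite eqxx.
  + by move=> id_; case: eqP => [[e]|_]; [have := Hr i id_; rewrite e ltnn | apply: Hv].
Qed.

(* A tautology in which [x] occurs: it makes a quantifier on [x] legitimate,
   since a prefix must range over exactly the free variables of its scope. *)
Definition mention (x : nat) : sl AP Ag :=
  let g := bind_profile (fun=> x) (Next (Atom ord0)) in Or g (Not g).

Definition to_sl (f : fo) : sl AP Ag :=
  quantify (prenex_prefix 0 f)
    (foldr (fun x psi => And (mention x) psi) (prenex_matrix id 0 f)
       (iota 0 (quantifiers f))).

Lemma mem_free_mention x w : (w \in sl_free (mention x)) = (w == inr x).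
Proof.
rewrite /mention /= mem_cat orbb mem_free_bind_all ?enum_uniq //=.
rewrite cats0; case: w => [a|y]; first by rewrite mem_enum.
have -> : (inr y \in [seq inl i | i <- enum Ag]) = false by apply/mapP => -[].
apply/hasP/eqP => [[a _ /andP[_ /eqP->]] // | [->]].
by exists ord0; rewrite ?mem_enum // map_f ?eqxx // mem_enum.
Qed.

Lemma mem_free_mentions xs psi w :
  (w \in sl_free (foldr (fun x psi => And (mention x) psi) psi xs)) =
  (w \in [seq inr x | x <- xs]) || (w \in sl_free psi).
Proof.
elim: xs => //= x xs IH.
by rewrite -/(sl_free (mention x)) mem_cat mem_free_mention IH inE orbA.
Qed.

Lemma binding_prefix_profile (sigma : Ag -> nat) :
  binding_prefix [seq (a, sigma a) | a <- enum Ag].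
Proof. by rewrite /binding_prefix /unzip1 -map_comp map_id. Qed.

Lemma bgoal_mention x : bgoal (mention x).
Proof.
have B : bgoal (bind_profile (fun=> x) (Next (Atom ord0))).
  by apply: bgoal_bind (binding_prefix_profile _) _; apply/bg_next/bg_atom.
exact: bgoal_or B (bgoal_not B).
Qed.

Lemma bgoal_prenex_matrix rho k f : bgoal (prenex_matrix rho k f).
Proof.
elim: f rho k => [t|f IH|f IHf g IHg|f IHf g IHg|f IH|f IH] rho k //=.
- by case: (goal_path t) => Hg _; apply: bgoal_bind (binding_prefix_profile _) _.
- exact/bgoal_not/IH.
- by apply: bgoal_and; [apply: IHf | apply: IHg].
- apply/bgoal_not/bgoal_and; first exact: IHf.
  exact/bgoal_not/IHg.
Qed.

Section ToSl.
Variable f : fo.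
Hypothesis sf : scope 0 f.

Lemma free_to_sl w : w \notin sl_free (to_sl f).
Proof.
rewrite mem_free_quantify unzip2_prenex_prefix mem_free_mentions.
case: (boolP (w \in _)) => //= Hw.
apply/negP => /(free_prenex_matrix sf) [] // x wx [[] // | /andP[_ x1]].
by rewrite wx map_f // mem_iota in Hw.
Qed.

Lemma slbg_to_sl : slbg (to_sl f).
Proof.
apply: bg_quantify; last first.
  elim: (iota _ _) => [|x xs IH] /=; first exact: bgoal_prenex_matrix.
  exact: bgoal_and (bgoal_mention x) IH.
split=> [|x]; rewrite unzip2_prenex_prefix ?iota_uniq // mem_free_mentions.
rewrite mem_map; last by move=> ? ? [].
case: (boolP (x \in _)) => //= Hx; symmetry.
apply/negP => /(free_prenex_matrix sf) [] // _ [<-] [[] // | /andP[_ x1]].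
by rewrite mem_iota x1 in Hx.
Qed.

(** Each [mention] is true by excluded middle, so adding them preserves the prenex form up to
    equivalence. With no index in scope, [chi] and [v] are arbitrary. *)
Lemma sat_to_sl (G : cgs AP Ag) chi (s : states G) v :
  sat (to_sl f) chi s <-> fsat f s v.
Proof.
apply: iff_trans (_ : sat (quantify (prenex_prefix 0 f) (prenex_matrix id 0 f)) chi s <-> _);
  last exact: (sat_prenex (d := 0)).
apply: sat_quantify_iff => c; elim: (iota _ _) => //= x xs IH.
by split=> [[_ /IH]|/IH] //; split=> //; apply: EM.
Qed.

End ToSl.

End Prenex.

(** * One-step and two-step goals for four agents *)

Section Atoms.
Variable k : nat.
Notation AP := 'I_(7 + k).+1.
Notation Ag := 'I_4.
Notation cgs4 := (cgs AP Ag).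

Definition lab (r : nat) : AP := inord r.

Definition prof (T : Type) (a b c d : T) : {ffun Ag -> T} :=
  [ffun i : Ag => nth a [:: a; b; c; d] i].

Lemma profE (T : Type) (v : nat -> T) x y z w :
  [ffun i : Ag => v (nth 0 [:: x; y; z; w] i)] = prof (v x) (v y) (v z) (v w).
Proof. by apply/ffunP => -[[|[|[|[|i]]]] Hi]; rewrite !ffunE. Qed.

Lemma sat_next_atom (G : cgs4) p (sg : Ag -> strategy G) s :
  sat (Next (Atom p)) (profile_asg sg) s <->
  p \in label (trans s [ffun a => sg a [:: s]]).
Proof. exact: sat_next. Qed.

Lemma translate_profile (G : cgs4) (sg : Ag -> strategy G) h :
  translate (profile_asg sg) h = profile_asg (fun a h' => sg a (h ++ h')).
Proof. by apply/funext => -[]. Qed.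

Lemma free_agents (phi : sl AP Ag) :
  (forall x, inr x \notin sl_free phi) -> forall x, inr x \notin sl_free (Next phi).
Proof.
by move=> H x /=; rewrite mem_cat negb_or H andbT; apply/mapP => -[].
Qed.

Definition child (G : cgs4) (s : states G) (a u : actions G) : states G :=
  trans s (prof a a a u).

Inductive local_atom := Step of nat & nat & nat.

Definition local_goal t : sl AP Ag := let: Step r _ _ := t in Next (Atom (lab r)).

Definition local_vars t := let: Step _ x u := t in [:: x; x; x; u].

Definition local_sem (G : cgs4) t (s : states G) (v : nat -> strategy G) : Prop :=
  let: Step r x u := t in
  lab r \in label (child s (v x [:: s]) (v u [:: s])).

Lemma local_goal_path t : path_formula (local_goal t).
Proof.
by case: t => r x u; split; [apply/bg_next/bg_atom | apply: free_agents].
Qed.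

Lemma local_semP (G : cgs4) t (s : states G) v :
  sat (local_goal t) (profile_asg (fun a : Ag => v (nth 0 (local_vars t) a))) s <->
  local_sem t s v.
Proof.
case: t => r x u; rewrite /local_goal /local_sem.
apply: iff_trans (sat_next_atom _ _ _) _.
by rewrite /local_vars (profE (fun i => v i [:: s])).
Qed.

(** Labels 0 to 4 stand for zero, successor, equality, addition and multiplication, label 5 marks
    the input, and label [8 + i] the guessed set [i]. Labels 6 and 7 are read only after two
    steps. *)
Definition p_lab := 6.
Definition q_lab := 7.

(* After one more step, agent 3 alone controls [p_lab], and agents 0, 1, 2
   alone control [q_lab]. *)
Definition control : fo local_atom :=
  FAnd (FAnd (FAll (FAll (FAll (FImp (Goal (Step p_lab 0 2)) (Goal (Step p_lab 1 2))))))
             (FAnd (FEx (Goal (Step p_lab 0 0)))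
                   (FEx (FNot (Goal (Step p_lab 0 0))))))
       (FAnd (FAll (FAll (FAll (FImp (Goal (Step q_lab 2 0)) (Goal (Step q_lab 2 1))))))
             (FAnd (FEx (Goal (Step q_lab 0 0)))
                   (FEx (FNot (Goal (Step q_lab 0 0)))))).

Inductive atom :=
| Rel of nat & nat & nat & nat
| Test of nat & nat & nat
| Control of nat & nat.

Definition atom_goal t : sl AP Ag :=
  match t with
  | Rel r _ _ _ => Next (Atom (lab r))
  | Test r _ _ => Next (Next (Atom (lab r)))
  | Control _ _ => Next (to_sl local_goal local_vars control)
  end.

Definition atom_vars t :=
  match t with
  | Rel _ x y z => [:: x; y; z; x]
  | Test _ x u | Control x u => [:: x; x; x; u]
  end.

Definition reports (G : cgs4) (s : states G) r (a b c : actions G) : Prop :=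
  lab r \in label (trans s (prof a b c a)).

Definition atom_sem (G : cgs4) t (s : states G) (v : nat -> strategy G) : Prop :=
  match t with
  | Rel r x y z => reports s r (v x [:: s]) (v y [:: s]) (v z [:: s])
  | Test r x u =>
      let s1 := child s (v x [:: s]) (v u [:: s]) in
      lab r \in label (child s1 (v x [:: s; s1]) (v u [:: s; s1]))
  | Control x u => fsat local_sem control (child s (v x [:: s]) (v u [:: s])) v
  end.

Lemma atom_goal_path t : path_formula (atom_goal t).
Proof.
case: t => [r x y z|r x u|x u] /=.
- by split; [apply/bg_next/bg_atom | apply: free_agents].
- by split; [apply/bg_next/bg_next/bg_atom | apply/free_agents/free_agents].
split; first exact/bg_next/(slbg_to_sl local_goal_path).
by apply: free_agents => y; apply: (free_to_sl local_goal_path).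
Qed.

Lemma atom_semP (G : cgs4) t (s : states G) v :
  sat (atom_goal t) (profile_asg (fun a : Ag => v (nth 0 (atom_vars t) a))) s <->
  atom_sem t s v.
Proof.
case: t => [r x y z|r x u|x u]; rewrite /atom_goal /atom_sem.
- apply: iff_trans (sat_next_atom _ _ _) _.
  by rewrite /atom_vars (profE (fun i => v i [:: s])).
- apply: iff_trans (sat_next _ _ _) _; rewrite translate_profile.
  rewrite (profE (fun i => v i [:: s])).
  apply: iff_trans (sat_next_atom _ _ _) _ => /=.
  by rewrite (profE (fun i => v i [:: s; _])).
apply: iff_trans (sat_next _ _ _) _.
rewrite (profE (fun i => v i [:: s])).
exact: (sat_to_sl local_goal_path local_semP).
Qed.

End Atoms.

(** * Arithmetic in the initial state *)

Section Structures.
Variables (T : Type) (R : nat -> T -> T -> T -> Prop).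
Notation zero a := (R 0 a a a).
Notation succ a b := (R 1 a b b).
Notation equal a b := (R 2 a b b).
Notation add a b c := (R 3 a b c).
Notation mul a b c := (R 4 a b c).

(** Several actions may represent one number, so equality is a relation symbol with its own axioms.
    Induction is kept apart, as the hypothesis [numerals] below. *)
Record peano (k : nat) : Prop := Peano {
  ex_zero : exists a, zero a;
  ex_succ : forall a, exists b, succ a b;
  zero_succ : forall a b, zero b -> ~ succ a b;
  succ_inj : forall a b c, succ a c -> succ b c -> equal a b;
  equal_zero : forall a b, equal a b -> zero a -> zero b;
  equal_succr : forall a b c, equal a b -> succ c a -> succ c b;
  equal_succl : forall a b c, equal a b -> succ a c -> succ b c;
  zero_equal : forall a b, zero a -> zero b -> equal a b;
  succ_equal : forall a a' b b',
    succ a a' -> succ b b' -> equal a b -> equal a' b';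
  add_zero : forall a b c, zero a -> add a b c <-> equal b c;
  add_succ : forall a a' b c, succ a a' ->
    add a' b c <-> exists d, succ d c /\ add a b d;
  mul_zero : forall a b c, zero a -> mul a b c <-> zero c;
  mul_succ : forall a a' b c, succ a a' ->
    mul a' b c <-> exists d, mul a b d /\ add d b c;
  equal_set : forall i a b, i < k -> equal a b -> R (8 + i) a a a -> R (8 + i) b b b
}.

(** [num n a] reads: action [a] represents the number [n]. The clauses identify actions, up to
    [equal], with the natural numbers. *)
Record standard (num : nat -> T -> Prop) (k : nat) : Prop := Standard {
  num_total : forall a, exists n, num n a;
  num_onto : forall n, exists a, num n a;
  num_zero : forall n a, num n a -> zero a <-> n = 0;
  num_succ : forall n m a b, num n a -> num m b -> succ a b <-> m = n.+1;
  num_equal : forall n m a b, num n a -> num m b -> equal a b <-> n = m;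
  num_add : forall n m l a b c, num n a -> num m b -> num l c ->
    add a b c <-> n + m = l;
  num_mul : forall n m l a b c, num n a -> num m b -> num l c ->
    mul a b c <-> n * m = l;
  num_set : forall n a b i, i < k -> num n a -> num n b ->
    R (8 + i) a a a -> R (8 + i) b b b
}.

Fixpoint numeral (n : nat) (a : T) : Prop :=
  if n is m.+1 then exists2 b, numeral m b & succ b a else zero a.

Section Numerals.
Variables (k : nat) (ax : peano k).
Hypothesis numerals : forall a, exists n, numeral n a.

Lemma equal_numeral n a b : equal a b -> numeral n a -> numeral n b.
Proof.
case: n => [|n] /= ab; first exact: (equal_zero ax) ab.
by case=> c cn ca; exists c => //; apply: (equal_succr ax) ab ca.
Qed.

Lemma numeral_inj n m a : numeral n a -> numeral m a -> n = m.
Proof.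
elim: n m a => [|n IH] [|m] a //=.
- by move=> a0 [b _ /(zero_succ ax)]; case.
- by case=> b _ ba a0; case: (zero_succ ax a0 ba).
case=> b bn ba [c cm ca]; congr _.+1; apply: (IH _ c) cm.
by apply: equal_numeral bn; apply: (succ_inj ax) ba ca.
Qed.

Lemma numeral_equal n a b : numeral n a -> numeral n b -> equal a b.
Proof.
elim: n a b => [|n IH] a b /=; first exact: (zero_equal ax).
by case=> a' an aa [b' bn bb]; apply: (succ_equal ax) aa bb (IH _ _ an bn).
Qed.

(** Addition and multiplication are settled by induction on the first argument, along their
    recursion axioms. *)
Lemma numeral_standard : standard numeral k.
Proof.
have E n m a b : numeral n a -> numeral m b -> equal a b <-> n = m.
  move=> an bm; split=> [ab|nm]; last by rewrite -nm in bm; apply: numeral_equal bm.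
  by apply: numeral_inj bm; apply: equal_numeral an.
have S n m a b : numeral n a -> numeral m b -> succ a b <-> m = n.+1.
  move=> an bm; split=> [ab|nm]; first by apply: numeral_inj bm _; exists a.
  move: bm; rewrite nm => -[c cn cb].
  by apply: (equal_succl ax) cb; apply: numeral_equal an.
have Z n a : numeral n a -> zero a <-> n = 0.
  by move=> an; split=> [a0|n0]; [apply: numeral_inj an _ | rewrite n0 in an].
have A n m l a b c : numeral n a -> numeral m b -> numeral l c ->
    add a b c <-> n + m = l.
  elim: n a l c => [|n IH] a l c /=.
    move=> a0 bm cl; apply: iff_trans (add_zero ax _ _ a0) _.
    exact: E.
  case=> a' an aa bm cl; apply: iff_trans (add_succ ax _ _ aa) _.
  split=> [[d [dc abd]]|].
    (* The intermediate value [d] is an arbitrary action; the induction hypothesis needs it to be a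
       numeral. *)
    have [j dj] := numerals d.
    have lj := (S _ _ _ _ dj cl).1 dc.
    by rewrite lj addSn ((IH _ _ _ an bm dj).1 abd).
  rewrite addSn => nml; move: cl; rewrite -nml => -[d dj dc].
  by exists d; split=> //; apply/(IH _ _ _ an bm dj).
split=> //.
- elim=> [|n [a an]]; first exact: ex_zero ax.
  by have [b ab] := ex_succ ax a; exists b; exists a.
- move=> n m l a b c; elim: n a l c => [|n IH] a l c /=.
    move=> a0 bm cl; apply: iff_trans (mul_zero ax _ _ a0) _.
    by rewrite mul0n; split=> [/(Z _ _ cl)|/esym/(Z _ _ cl)].
  case=> a' an aa bm cl; apply: iff_trans (mul_succ ax _ _ aa) _.
  have onto : forall j, exists d, numeral j d.
    elim=> [|j [d dj]]; first exact: ex_zero ax.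
    by have [e de] := ex_succ ax d; exists e; exists d.
  split=> [[d [abd dbc]]|nml].
    have [j dj] := numerals d.
    rewrite mulSn addnC ((IH _ _ _ an bm dj).1 abd).
    exact/(A _ _ _ _ _ _ dj bm cl).
  have [d dj] := onto (n * m); exists d; split; first exact/(IH _ _ _ an bm dj).
  by apply/(A _ _ _ _ _ _ dj bm cl); rewrite addnC -mulSn.
- move=> n a b i ik an bn; apply: (equal_set ax ik).
  exact: numeral_equal an bn.
Qed.

End Numerals.
End Structures.

(** * Translation of arithmetical formulas into first-order combinations of goals *)

Section Translation.
Variable k : nat.
Notation AP := 'I_(7 + k).+1.
Notation cgs4 := (cgs AP 'I_4).

Definition zeroA x := Goal (Rel 0 x x x).
Definition succA x y := Goal (Rel 1 x y y).
Definition equalA x y := Goal (Rel 2 x y y).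
Definition addA x y z := Goal (Rel 3 x y z).
Definition mulA x y z := Goal (Rel 4 x y z).
Definition inputA x := Goal (Rel 5 x x x).
Definition setA i x := Goal (Rel (8 + i) x x x).

(* "[t] has value [y]".  Index [i] of [t] is the strategy variable
   [minn i l + d]; the variable [l + d] stands for [0], the value of the number
   variables outside the environment. *)
Fixpoint term_fo (l d : nat) (t : aterm) (y : nat) : fo atom :=
  match t with
  | AVar i => equalA (minn i l + d) y
  | AZero => zeroA y
  | ASucc t => FEx (FAnd (term_fo l d.+1 t 0) (succA 0 y.+1))
  | AAdd t u =>
      FEx (FEx (FAnd (FAnd (term_fo l d.+2 t 0) (term_fo l d.+2 u 1))
                     (addA 0 1 y.+2)))
  | AMul t u =>
      FEx (FEx (FAnd (FAnd (term_fo l d.+2 t 0) (term_fo l d.+2 u 1))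
                     (mulA 0 1 y.+2)))
  end.

(** [l] counts the number variables in scope, and the strategy variable of index [l] is the zero
    used by [minn i l]. The value of a term is held by one extra quantifier, hence the shift 1. *)
Fixpoint form_fo (l : nat) (phi : aform k) : fo atom :=
  match phi with
  | AEq t u => FEx (FAnd (term_fo l 1 t 0) (term_fo l 1 u 0))
  | AMem t i => FEx (FAnd (term_fo l 1 t 0) (setA i 0))
  | ANot f => FNot (form_fo l f)
  | AAnd f g => FAnd (form_fo l f) (form_fo l g)
  | AOr f g => FImp (FNot (form_fo l f)) (form_fo l g)
  | AEx f => FEx (form_fo l.+1 f)
  | AAll f => FAll (form_fo l.+1 f)
  end.

Lemma scope_term_fo l d t y c : l + d < c -> y < c -> scope atom_vars c (term_fo l d t y).
Proof.
elim: t d y c => [i||t IH|t IHt u IHu|t IHt u IHu] d y c ldc yc /=.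
- have ic : minn i l + d < c by apply: leq_ltn_trans ldc; rewrite leq_add2r geq_minr.
  by rewrite ic yc (leq_ltn_trans _ yc).
- by rewrite yc (leq_ltn_trans _ yc).
- by rewrite !ltnS yc IH ?addnS.
- by rewrite !ltnS yc IHt ?IHu ?addnS.
- by rewrite !ltnS yc IHt ?IHu ?addnS.
Qed.

Lemma scope_form_fo l phi : scope atom_vars l.+1 (form_fo l phi).
Proof.
elim: phi l => [t u|t i|f IH|f IHf g IHg|f IHf g IHg|f IH|f IH] l //=;
  by rewrite ?scope_term_fo ?addn1 ?IHf ?IHg ?IH.
Qed.

Section Semantics.
Variables (G : cgs4) (s : states G) (num : nat -> actions G -> Prop).
Hypothesis std : standard (reports s) num k.

Notation now st := (st [:: s]).
Notation holds := (fsat (@atom_sem k) (G := G)).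

Lemma num_strategy n : exists st : strategy G, num n (now st).
Proof. by have [a an] := num_onto std n; exists (fun=> a). Qed.

(** For large [i] the hypothesis on [e] says that variable [l + d] represents 0, the default of
    [nth]. *)
Lemma fsat_term_fo l d t y e v n :
  (forall i, num (nth 0 e i) (now (v (minn i l + d)))) -> num n (now (v y)) ->
  holds (term_fo l d t y) s v <-> aeval e t = n.
Proof.
elim: t d y v n => [i||t IH|t IHt u IHu|t IHt u IHu] d y v n He Hn /=.
- by apply: (num_equal std).
- by apply: iff_trans (num_zero std Hn) _; split=> ->.
- have IH' st j : num j (now st) ->
      holds (term_fo l d.+1 t 0) s (scons st v) <-> aeval e t = j.
    by move=> stj; apply: IH => // i; rewrite addnS.
  split=> [[st [+ H]]|H].
    have [j stj] := num_total std (now st); move/(IH' _ _ stj) ->.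
    by move/(num_succ std stj Hn): H ->.
  have [st stj] := num_strategy (aeval e t); exists st; split; first exact/(IH' _ _ stj).
  by apply/(num_succ std stj Hn).
- have IH' st st' j j' : num j (now st) -> num j' (now st') ->
      (holds (term_fo l d.+2 t 0) s (scons st (scons st' v)) <-> aeval e t = j) /\
      (holds (term_fo l d.+2 u 1) s (scons st (scons st' v)) <-> aeval e u = j').
    by split; [apply: IHt | apply: IHu] => // i; rewrite !addnS.
  split=> [[st' [st [[H1 H2] H]]]|H].
    have [j stj] := num_total std (now st); have [j' stj'] := num_total std (now st').
    have [E1 E2] := IH' _ _ _ _ stj stj'.
    by rewrite (E1.1 H1) (E2.1 H2); apply/(num_add std stj stj' Hn).
  have [st stj] := num_strategy (aeval e t); have [st' stj'] := num_strategy (aeval e u).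
  have [E1 E2] := IH' _ _ _ _ stj stj'.
  exists st', st; split; first by split; [apply/E1 | apply/E2].
  exact/(num_add std stj stj' Hn).
- have IH' st st' j j' : num j (now st) -> num j' (now st') ->
      (holds (term_fo l d.+2 t 0) s (scons st (scons st' v)) <-> aeval e t = j) /\
      (holds (term_fo l d.+2 u 1) s (scons st (scons st' v)) <-> aeval e u = j').
    by split; [apply: IHt | apply: IHu] => // i; rewrite !addnS.
  split=> [[st' [st [[H1 H2] H]]]|H].
    have [j stj] := num_total std (now st); have [j' stj'] := num_total std (now st').
    have [E1 E2] := IH' _ _ _ _ stj stj'.
    by rewrite (E1.1 H1) (E2.1 H2); apply/(num_mul std stj stj' Hn).
  have [st stj] := num_strategy (aeval e t); have [st' stj'] := num_strategy (aeval e u).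
  have [E1 E2] := IH' _ _ _ _ stj stj'.
  exists st', st; split; first by split; [apply/E1 | apply/E2].
  exact/(num_mul std stj stj' Hn).
Qed.

Definition read_set (i : 'I_k) (n : nat) : Prop :=
  exists2 a, num n a & reports s (8 + i) a a a.

(** Here a strategy counts only through its action at [[:: s]], and by [std] actions represent
    exactly the natural numbers, so strategy quantifiers become number quantifiers. *)
Lemma fsat_form_fo l phi e v :
  (forall i, num (nth 0 e i) (now (v (minn i l)))) ->
  holds (form_fo l phi) s v <-> aholds read_set e phi.
Proof.
have term st w f l' t j : (forall i, num (nth 0 f i) (now (w (minn i l')))) ->
    num j (now st) -> holds (term_fo l' 1 t 0) s (scons st w) <-> aeval f t = j.
  by move=> H stj; apply: fsat_term_fo => // i; rewrite addn1.
have push st w f l' j : (forall i, num (nth 0 f i) (now (w (minn i l')))) ->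
    num j (now st) ->
    forall i, num (nth 0 (j :: f) i) (now (scons st w (minn i l'.+1))).
  by move=> H stj [|i] //=; rewrite minnSS /=.
elim: phi l e v => [t u|t i|f IH|f IHf g IHg|f IHf g IHg|f IH|f IH] l e v He /=.
- split=> [[st [+ +]]|E].
    have [j stj] := num_total std (now st).
    by move=> /(term _ _ _ _ _ _ He stj)-> /(term _ _ _ _ _ _ He stj)->.
  have [st stj] := num_strategy (aeval e t).
  by exists st; split; apply/(term _ _ _ _ _ _ He stj).
- split=> [[st [+ H]]|[a aj H]].
    have [j stj] := num_total std (now st); move=> /(term _ _ _ _ _ _ He stj)->.
    by exists (now st).
  exists (fun=> a); split=> //; first exact/(term (fun=> a) _ _ _ _ _ He aj).
- by rewrite (propext (IH _ _ _ He)).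
- by rewrite (propext (IHf _ _ _ He)) (propext (IHg _ _ _ He)).
- rewrite (propext (IHf _ _ _ He)) (propext (IHg _ _ _ He)).
  by split=> [H|[]//]; case: (EM (aholds read_set e f)) => [|/H]; [left|right].
- split=> [[st Hst]|[j Hj]].
    have [j stj] := num_total std (now st); exists j.
    exact: (IH _ _ _ (push _ _ _ _ _ He stj)).1 Hst.
  have [st stj] := num_strategy j; exists st.
  exact: (IH _ _ _ (push _ _ _ _ _ He stj)).2 Hj.
- split=> [H j|H st].
    have [st stj] := num_strategy j.
    exact: (IH _ _ _ (push _ _ _ _ _ He stj)).1 (H st).
  have [j stj] := num_total std (now st).
  exact: (IH _ _ _ (push _ _ _ _ _ He stj)).2 (H j).
Qed.
End Semantics.
End Translation.

(** * The sentence and its models *)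

#[local] Arguments child {k G} s a u : simpl never.
#[local] Arguments reports {k G} s r a b c : simpl never.

Section TheSentence.
Variable k : nat.
Notation AP := 'I_(7 + k).+1.
Notation cgs4 := (cgs AP 'I_4).

Definition inA x u := Goal (Test p_lab x u).
Definition signalA x u := Goal (Test q_lab x u).

(** The axioms of [peano] in the same order, up to [mul_succ]; the outermost quantifier has the
    highest index. *)
Definition arith_fo : seq (fo atom) := [::
  FEx (zeroA 0);
  FAll (FEx (succA 1 0));
  FAll (FAll (FImp (zeroA 0) (FNot (succA 1 0))));
  FAll (FAll (FAll (FImp (succA 2 0) (FImp (succA 1 0) (equalA 2 1)))));
  FAll (FAll (FImp (equalA 1 0) (FImp (zeroA 1) (zeroA 0))));
  FAll (FAll (FAll (FImp (equalA 2 1) (FImp (succA 0 2) (succA 0 1)))));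
  FAll (FAll (FAll (FImp (equalA 2 1) (FImp (succA 2 0) (succA 1 0)))));
  FAll (FAll (FImp (zeroA 1) (FImp (zeroA 0) (equalA 1 0))));
  FAll (FAll (FAll (FAll (FImp (succA 3 2) (FImp (succA 1 0)
    (FImp (equalA 3 1) (equalA 2 0)))))));
  FAll (FAll (FAll (FImp (zeroA 2) (FIff (addA 2 1 0) (equalA 1 0)))));
  FAll (FAll (FAll (FAll (FImp (succA 3 2)
    (FIff (addA 2 1 0) (FEx (FAnd (succA 0 1) (addA 4 2 0))))))));
  FAll (FAll (FAll (FImp (zeroA 2) (FIff (mulA 2 1 0) (zeroA 0)))));
  FAll (FAll (FAll (FAll (FImp (succA 3 2)
    (FIff (mulA 2 1 0) (FEx (FAnd (mulA 4 2 0) (addA 0 2 1))))))))].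

(* Agents 0, 1, 2 playing [x] and agent 3 playing [u] lead to a state that does
   not depend on the first action of [u], and that determines the first action
   of [x] up to [equalA]; the set of all [x] with [inA x u] is then arbitrary,
   so that the last formula is full second-order induction. *)
Definition induction_fo : seq (fo atom) := [::
  FAll (FAll (Goal (Control 1 0)));
  FAll (FAll (FAll (FImp (signalA 2 1) (signalA 2 0))));
  FAll (FAll (FImp (FNot (equalA 1 0)) (FEx (FAnd (inA 2 0) (FNot (inA 1 0))))));
  FAll (FImp (FAll (FImp (zeroA 0) (inA 0 1)))
       (FImp (FAll (FAll (FImp (succA 1 0) (FImp (inA 1 2) (inA 0 2)))))
             (FAll (inA 0 1))))].

Definition equal_set_fo i : fo atom :=
  FAll (FAll (FImp (equalA 1 0) (FImp (setA i 1) (setA i 0)))).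

(** The last conjunct fixes an action for zero, the value of number variables outside the
    environment, and then asserts [phi] of every action labelled as input. *)
Definition base_fo (phi : aform k) : fo atom :=
  foldr (@FAnd atom)
    (FEx (FAnd (zeroA 0) (FAll (FImp (inputA 0) (form_fo 1 phi)))))
    (arith_fo ++ induction_fo ++ [seq equal_set_fo i | i <- iota 0 k]).

Lemma scope_base_fo phi : scope atom_vars 0 (base_fo phi).
Proof.
rewrite /base_fo !foldr_cat.
set f := foldr _ _ [seq _ | _ <- _].
have Hf : scope atom_vars 0 f.
  rewrite {}/f; elim: (iota 0 k) => [|i l IH] //=.
  by rewrite scope_form_fo.
by rewrite /= Hf.
Qed.

Section Semantics.
Variables (G : cgs4) (s : states G).
Notation holds f v := (fsat (@atom_sem k) (G := G) f s v).

Lemma fsat_equal_sets l f v :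
  holds (foldr (@FAnd atom) f [seq equal_set_fo i | i <- l]) v <->
  (forall i, i \in l -> holds (equal_set_fo i) v) /\ holds f v.
Proof.
elim: l => [|i l IH]; first by split=> [|[]].
split=> [[Hi /IH[Hl Hf]]|[Hl Hf]].
  by split=> // j; rewrite inE => /orP[/eqP->|/Hl].
split; first by apply: Hl; rewrite mem_head.
by apply/IH; split=> // j jl; apply: Hl; rewrite inE jl orbT.
Qed.

Lemma fsat_arith_fo v f : peano (reports s) k -> holds f v ->
  holds (foldr (@FAnd atom) f arith_fo) v.
Proof.
case=> A1 A2 A3 A4 A5 A6 A7 A8 A9 A10 A11 A12 A13 _ Hf /=.
refine (conj _ (conj _ (conj _ (conj _ (conj _ (conj _ (conj _ (conj _ (conj _
  (conj _ (conj _ (conj _ (conj _ _))))))))))))) => //.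
- by have [a Ha] := A1; exists (fun=> a).
- by move=> st; have [a Ha] := A2 (st [:: s]); exists (fun=> a).
- by move=> st1 st2; apply: A3.
- by move=> st1 st2 st3; apply: A4.
- by move=> st1 st2; apply: A5.
- by move=> st1 st2 st3; apply: A6.
- by move=> st1 st2 st3; apply: A7.
- by move=> st1 st2; apply: A8.
- by move=> st1 st2 st3 st4; apply: A9.
- by move=> st1 st2 st3 H; split=> [/(A10 _ _ _ H)|/(A10 _ _ _ H)].
- move=> st1 st2 st3 st4 H; split=> [/(A11 _ _ _ _ H)[a Ha]|[st Hst]].
    by exists (fun=> a).
  by apply/(A11 _ _ _ _ H); exists (st [:: s]).
- by move=> st1 st2 st3 H; split=> [/(A12 _ _ _ H)|/(A12 _ _ _ H)].
- move=> st1 st2 st3 st4 H; split=> [/(A13 _ _ _ _ H)[a Ha]|[st Hst]].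
    by exists (fun=> a).
  by apply/(A13 _ _ _ _ H); exists (st [:: s]).
Qed.

Lemma peano_fo v f : holds (foldr (@FAnd atom) f arith_fo) v ->
  (forall i, i < k -> holds (equal_set_fo i) v) ->
  peano (reports s) k.
Proof.
(* One-step goals read a strategy only at [[:: s]], so constant strategies turn the formulas into
   statements about actions. *)
pose c (a : actions G) : strategy G := fun=> a.
move=> /= [A1 [A2 [A3 [A4 [A5 [A6 [A7 [A8 [A9 [A10 [A11 [A12 [A13 _]]]]]]]]]]]]] Aset.
split.
- by case: A1 => st Hst; exists (st [:: s]).
- by move=> a; case: (A2 (c a)) => st Hst; exists (st [:: s]).
- by move=> a b; exact: (A3 (c a) (c b)).
- by move=> a b d; exact: (A4 (c a) (c b) (c d)).
- by move=> a b; exact: (A5 (c a) (c b)).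
- by move=> a b d; exact: (A6 (c a) (c b) (c d)).
- by move=> a b d; exact: (A7 (c a) (c b) (c d)).
- by move=> a b; exact: (A8 (c a) (c b)).
- by move=> a a' b b'; exact: (A9 (c a) (c a') (c b) (c b')).
- by move=> a b d /(A10 (c a) (c b) (c d))[].
- move=> a a' b d aa'; have [H1 H2] := A11 (c a) (c a') (c b) (c d) aa'.
  split=> [/H1[st Hst]|[e He]]; first by exists (st [:: s]).
  by apply: H2; exists (c e).
- by move=> a b d /(A12 (c a) (c b) (c d))[].
- move=> a a' b d aa'; have [H1 H2] := A13 (c a) (c a') (c b) (c d) aa'.
  split=> [/H1[st Hst]|[e He]]; first by exists (st [:: s]).
  by apply: H2; exists (c e).
- by move=> i a b /Aset H; exact: (H (c a) (c b)).
Qed.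

(** * Every action is a numeral in every model of the induction formulas *)

Section Soundness.
Variables (v : nat -> strategy G) (f : fo atom).
Hypothesis ind : holds (foldr (@FAnd atom) f induction_fo) v.
Hypothesis ax : peano (reports s) k.

(** The content of [control] for actions: its universal quantifiers are instantiated with constant
    strategies. *)
Lemma child_control a u :
  [/\ (forall b c d, lab k p_lab \in label (child (child s a u) b d) ->
                     lab k p_lab \in label (child (child s a u) c d)),
      (exists d, lab k p_lab \in label (child (child s a u) d d)),
      (exists d, lab k p_lab \notin label (child (child s a u) d d)),
      (forall b c d, lab k q_lab \in label (child (child s a u) d b) ->
                     lab k q_lab \in label (child (child s a u) d c)) &
      (exists d, lab k q_lab \in label (child (child s a u) d d)) /\
      (exists d, lab k q_lab \notin label (child (child s a u) d d))].
Proof.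
case: ind => /(_ (fun=> a) (fun=> u)) [[H1 [[f1 Hf1] [g1 Hg1]]] [H2 [[f2 Hf2] [g2 Hg2]]]] _.
pose h := [:: child s a u].
split.
- by move=> b c d; exact: (H1 (fun=> d) (fun=> c) (fun=> b)).
- by exists (f1 h).
- by exists (g1 h); apply/negP.
- by move=> b c d; exact: (H2 (fun=> d) (fun=> c) (fun=> b)).
split; first by exists (f2 h).
by exists (g2 h); apply/negP.
Qed.

(** If the two states differed, agents 0, 1, 2 could tell them apart and make [q_lab] true after one
    and false after the other, against the second formula of [induction_fo]. *)
Lemma child_set_agent a u u' : child s a u = child s a u'.
Proof.
case: ind => _ [/= irr _]; case: (eqVneq (child s a u) (child s a u')) => // ne.
have [_ _ _ I1 [[f1 Hf1] _]] := child_control a u.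
have [_ _ _ I2 [_ [g2 /negP Hg2]]] := child_control a u'.
(* [t] plays [a] first, then [f1] in the state reached against [u] and [g2] elsewhere. *)
pose t : strategy G := fun h =>
  if size h == 1 then a else if last s h == child s a u then f1 else g2.
have /= := irr t (fun=> u) (fun=> u').
rewrite /t /= eqxx (negbTE (_ : child s a u' != child s a u)); last by rewrite eq_sym.
by move=> /(_ (I1 _ _ _ Hf1)) /(I2 _ g2)/Hg2.
Qed.

(* By [child_set_agent], the choice of [a] for agent 3 is immaterial. *)
Definition node (a : actions G) : states G := child s a a.

(** Otherwise some strategy of agent 3 would have [a] in its set and [b] outside. Both tests see the
    same history, so agent 3 answers alike, and [p_lab] depends on this answer alone. *)
Lemma node_equal a b : node a = node b -> reports s 2 a b b.
Proof.
case: ind => _ [_ [/= dist _]] ab; apply: contrapT => nab.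
have [w /=] := dist (fun=> a) (fun=> b) nab.
rewrite -!(child_set_agent a a) -!(child_set_agent b b) -/(node a) -/(node b) -ab => -[H []].
have [I1 _ _ _ _] := child_control a a.
exact: I1 H.
Qed.

(** Second-order induction is applied to the set of all numerals, realized by a strategy [u] of
    agent 3. *)
Lemma numerals_exhaustive a : exists n, numeral (reports s) n a.
Proof.
case: ind => _ [_ [_ [/= second_order _]]].
(* The set is one of states, since these are what the second move of agent 3 can depend on;
   [node_equal] leads back to actions. *)
pose Z (t : states G) := exists2 b, t = node b & exists n, numeral (reports s) n b.
(* At a node, [on] and [off] choose a common move of all agents making [p_lab] true or false;
   elsewhere [a] is a default. *)
have /choice[on Hon] : forall t, exists d, forall b, t = node b ->
    lab k p_lab \in label (child t d d).
  move=> t.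
  case: (pselect (exists b, t = node b)) => [[b ->]|nt].
    by have [_ [d Hd] _ _ _] := child_control b b; exists d.
  by exists a => b tb; case: nt; exists b.
have /choice[off Hoff] : forall t, exists d, forall b, t = node b ->
    lab k p_lab \notin label (child t d d).
  move=> t.
  case: (pselect (exists b, t = node b)) => [[b ->]|nt].
    by have [_ _ [d Hd] _ _] := child_control b b; exists d.
  by exists a => b tb; case: nt; exists b.
pose u : strategy G := fun h =>
  if size h == 1 then a else
  if `[< Z (last s h) >] then on (last s h) else off (last s h).
have inE (x : strategy G) :
    atom_sem (Test p_lab 0 1) s (scons x (scons u v)) <-> Z (node (x [:: s])).
  have E : child s (x [:: s]) (u [:: s]) = node (x [:: s]) by apply: child_set_agent.
  rewrite /atom_sem [scons _ _ 0]/= [scons _ _ 1]/= E.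
  have -> : u [:: s; node (x [:: s])] =
      if `[< Z (node (x [:: s])) >] then on (node (x [:: s])) else off (node (x [:: s])) by [].
  (* [on] and [off] were chosen with all agents moving alike; [I] lets agents 0, 1, 2 play the
     second move of [x] instead. *)
  have [I _ _ _ _] := child_control (x [:: s]) (x [:: s]).
  case: asboolP => [Zx|nZ]; split=> //.
    by move=> _; exact: I (Hon _ _ erefl).
  by move/I => /(_ (off (node (x [:: s])))); rewrite (negbTE (Hoff _ _ erefl)).
have [] : Z (node a).
  apply/(inE (fun=> a)); apply: second_order.
  - move=> x Hx; apply/inE; exists (x [:: s]) => //; by exists 0.
  move=> x y xy /inE[b xb [n bn]]; apply/inE; exists (y [:: s]) => //.
  exists n.+1, b => //; apply: (equal_succl ax) xy.
  exact: node_equal.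
move=> b ab [n bn]; exists n; apply: (equal_numeral ax) bn.
exact: node_equal.
Qed.
End Soundness.

Lemma base_fo_sound phi v n a : holds (base_fo phi) v ->
  numeral (reports s) n a -> reports s 5 a a a ->
  exists X : 'I_k -> nat -> Prop, aholds X [:: n] phi.
Proof.
rewrite /base_fo !foldr_cat => base na inp.
have ax : peano (reports s) k.
  apply: (peano_fo base) => i ik.
  move: base => [_ [_ [_ [_ [_ [_ [_ [_ [_ [_ [_ [_ [_ base]]]]]]]]]]]]].
  move: base => [_ [_ [_ [_ /fsat_equal_sets[sets _]]]]].
  by apply: sets; rewrite mem_iota.
move: base => [_ [_ [_ [_ [_ [_ [_ [_ [_ [_ [_ [_ [_ ind]]]]]]]]]]]]].
have std := numeral_standard ax (numerals_exhaustive ind ax).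
move: ind => [_ [_ [_ [_ /fsat_equal_sets[_ [z /= [z0 H]]]]]]].
exists (read_set s (numeral (reports s))).
(* Index 0 is the input and index 1 the action for zero, matching [[:: n]] with default 0. *)
have : holds (form_fo 1 phi) (scons (fun=> a) (scons z v)) := H (fun=> a) inp.
apply: (fsat_form_fo std _ _).1 => -[|i] //=.
by rewrite nth_nil.
Qed.

End Semantics.

(** * The intended model for given sets and a given input *)

Section IntendedModel.
Variables (X : 'I_k -> nat -> Prop) (n : nat).

Definition intended_rel (r a b c : nat) : Prop :=
  match r with
  | 0 => a = 0
  | 1 => b = a.+1
  | 2 => a = b
  | 3 => a + b = c
  | 4 => a * b = c
  | 5 => a = n
  | 6 | 7 => False
  | r.+4.+4 => exists2 i : 'I_k, r = i & X i a
  end.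

(** From the initial state [None], [inl] records the first moves of agents 0, 1, 2 and forgets that
    of agent 3. Then [inr] records whether the second moves of agents 3 and 0 are nonzero, and is
    absorbing. *)
Definition intended : cgs4 := @Cgs AP 'I_4 nat
  (option (nat * nat * nat + bool * bool)) (inhabits 0)
  (fun s => match s with
    | None => set0
    | Some (inl (a, b, c)) => [set l : AP | `[< intended_rel l a b c >]]
    | Some (inr (p, q)) =>
        [set l : AP | ((l == p_lab :> nat) && p) || ((l == q_lab :> nat) && q)]
    end)
  (fun s (act : {ffun 'I_4 -> nat}) => let act i Hi := act (@Ordinal 4 i Hi) in
    match s with
    | None => Some (inl (act 0 isT, act 1 isT, act 2 isT))
    | Some (inl _) => Some (inr (act 3 isT != 0, act 0 isT != 0))
    | Some (inr _) => s
    end)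
  None.

Lemma labE r : r < 8 + k -> lab k r = r :> nat.
Proof. exact: inordK. Qed.

Lemma reports_intended r (a b c : nat) : r < 8 + k ->
  reports (init intended) r a b c = intended_rel r a b c.
Proof.
move=> rk; apply/propext; rewrite /reports /= !ffunE /= inE labE //.
by split=> /asboolP.
Qed.

Lemma intended_arith : peano (reports (init intended)) k.
Proof.
split=> /=.
- by exists 0; rewrite reports_intended.
- by move=> a; exists a.+1; rewrite reports_intended.
- by move=> a b; rewrite !reports_intended // => /= ->.
- by move=> a b c; rewrite !reports_intended // => /= -> [].
- by move=> a b; rewrite !reports_intended // => /= ->.
- by move=> a b c; rewrite !reports_intended // => /= ->.
- by move=> a b c; rewrite !reports_intended // => /= ->.
- by move=> a b; rewrite !reports_intended // => /= -> ->.
- by move=> a a' b b'; rewrite !reports_intended // => /= -> -> ->.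
- by move=> a b c; rewrite !reports_intended // => /= ->; rewrite add0n.
- move=> a a' b c; rewrite !reports_intended // => /= ->; split=> [<-|[d]].
    by exists (a + b); rewrite !reports_intended //= addSn.
  by rewrite !reports_intended //= => -[-> <-].
- by move=> a b c; rewrite !reports_intended // => /= ->; rewrite mul0n; split=> ->.
- move=> a a' b c; rewrite !reports_intended // => /= ->; split=> [<-|[d]].
    by exists (a * b); rewrite !reports_intended //= mulSn addnC.
  by rewrite !reports_intended //= => -[<- <-]; rewrite mulSn addnC.
by move=> i a b ik; rewrite !reports_intended ?ltn_add2l // => /= ->.
Qed.

Lemma intended_standard :
  standard (reports (init intended)) (fun n (a : actions intended) => n = a) k.
Proof.
split=> /=.
- by move=> a; exists a.
- by move=> j; exists j.
- by move=> j a ->; rewrite reports_intended.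
- by move=> i j a b -> ->; rewrite reports_intended.
- by move=> i j a b -> ->; rewrite reports_intended.
- by move=> i j l a b c -> -> ->; rewrite reports_intended.
- by move=> i j l a b c -> -> ->; rewrite reports_intended.
- by move=> j a b i ik -> ->.
Qed.

Lemma child_intended (a u : nat) :
  child (init intended) a u = Some (inl (a, a, a)).
Proof. by rewrite /child /= !ffunE. Qed.

Lemma grandchild_intended abc (a u : nat) :
  child (Some (inl abc) : states intended) a u = Some (inr (u != 0, a != 0)).
Proof. by case: abc => -[? ?] ?; rewrite /child /= !ffunE. Qed.

Lemma p_intended (p q : bool) :
  (lab k p_lab \in label (Some (inr (p, q)) : states intended)) = p.
Proof. by rewrite /= inE labE ?leq_addr //= orbF. Qed.

Lemma q_intended (p q : bool) :
  (lab k q_lab \in label (Some (inr (p, q)) : states intended)) = q.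
Proof. by rewrite /= inE labE ?leq_addr. Qed.

Definition number (a : nat) : states intended := Some (inl (a, a, a)).

Lemma step_p abc x u (w : nat -> strategy intended) :
  local_sem (Step p_lab x u) (Some (inl abc) : states intended) w <->
  w u [:: (Some (inl abc) : states intended)] != 0.
Proof. by rewrite /local_sem grandchild_intended p_intended. Qed.

Lemma step_q abc x u (w : nat -> strategy intended) :
  local_sem (Step q_lab x u) (Some (inl abc) : states intended) w <->
  w x [:: (Some (inl abc) : states intended)] != 0.
Proof. by rewrite /local_sem grandchild_intended q_intended. Qed.

Lemma test_p x u (w : nat -> strategy intended) :
  atom_sem (Test p_lab x u) (init intended) w <->
  (w u [:: init intended; number (w x [:: init intended])] != 0).
Proof. by rewrite /atom_sem child_intended grandchild_intended p_intended. Qed.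

Lemma test_q x u (w : nat -> strategy intended) :
  atom_sem (Test q_lab x u) (init intended) w <->
  (w x [:: init intended; number (w x [:: init intended])] != 0).
Proof. by rewrite /atom_sem child_intended grandchild_intended q_intended. Qed.

Lemma intended_control abc v :
  fsat (@local_sem k) control (Some (inl abc) : states intended) v.
Proof.
split; (split; last split).
- move=> a b c H; apply: (step_p abc 1 2 (scons c (scons b (scons a v)))).2.
  exact: (step_p abc 0 2 (scons c (scons b (scons a v)))).1 H.
- by exists (fun=> 1); apply: (step_p abc 0 0 (scons (fun=> 1) v)).2.
- by exists (fun=> 0) => H; have := (step_p abc 0 0 (scons (fun=> 0) v)).1 H.
- move=> a b c H; apply: (step_q abc 2 1 (scons c (scons b (scons a v)))).2.
  exact: (step_q abc 2 0 (scons c (scons b (scons a v)))).1 H.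
- by exists (fun=> 1); apply: (step_q abc 0 0 (scons (fun=> 1) v)).2.
- by exists (fun=> 0) => H; have := (step_q abc 0 0 (scons (fun=> 0) v)).1 H.
Qed.

Lemma intended_induction f v : fsat (@atom_sem k) f (init intended) v ->
  fsat (@atom_sem k) (foldr (@FAnd atom) f induction_fo) (init intended) v.
Proof.
move=> Hf; refine (conj _ (conj _ (conj _ (conj _ Hf)))).
- move=> st st'; rewrite /fsat /atom_sem child_intended; exact: intended_control.
- move=> t u u' H; apply: (test_q 2 0 (scons u' (scons u (scons t v)))).2.
  exact: (test_q 2 1 (scons u' (scons u (scons t v)))).1 H.
- move=> x y nxy; have xy : ~ atom_sem (Rel 2 1 0 0) (init intended) (scons y (scons x v)) := nxy.
  (* Agent 3 answers 1 exactly at the node of [x]: its set is a singleton. *)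
  pose w : strategy intended := fun h => last (init intended) h == number (x [:: init intended]).
  exists w; split.
    apply: (test_p 2 0 (scons w (scons y (scons x v)))).2.
    by rewrite /= /w /= eqxx.
  move/(test_p 1 0 (scons w (scons y (scons x v)))).1; rewrite /= /w /=.
  rewrite eqb0 negbK => /eqP[yx _ _]; apply: xy.
  by rewrite /atom_sem reports_intended.
- move=> u H0 HS z.
  (* The second moves of [u] define a set of numbers, and induction for it is induction on [nat];
     constant strategies supply the numbers. *)
  have H j : u [:: init intended; number j] != 0.
    elim: j => [|j IH].
      apply: (test_p 0 1 (scons (fun=> 0) (scons u v))).1; apply: H0.
      by change (reports (init intended) 0 0 0 0); rewrite reports_intended.
    apply: (test_p 0 2 (scons (fun=> j.+1) (scons (fun=> j) (scons u v)))).1.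
    apply: HS; first by change (reports (init intended) 1 j j.+1 j.+1); rewrite reports_intended.
    exact: (test_p 1 2 (scons (fun=> j.+1) (scons (fun=> j) (scons u v)))).2 IH.
  by apply: (test_p 0 1 (scons z (scons u v))).2; apply: H.
Qed.

Lemma base_fo_complete phi v : aholds X [:: n] phi ->
  fsat (@atom_sem k) (base_fo phi) (init intended) v.
Proof.
move=> Hphi; rewrite /base_fo !foldr_cat.
apply: fsat_arith_fo intended_arith _; apply: intended_induction.
apply/fsat_equal_sets; split.
  move=> i; rewrite mem_iota => /= ik st st'.
  by rewrite /= !reports_intended ?ltn_add2l // => /= ->.
exists (fun=> 0); split; first by rewrite /= reports_intended.
move=> st; rewrite /= reports_intended //= => stn.
have env i : nth 0 [:: n] i = scons st (scons (fun=> 0) v) (minn i 1) [:: init intended].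
  by case: i => [|i] /=; rewrite ?stn ?nth_nil.
apply: (fsat_form_fo intended_standard phi env).2.
have -> // : read_set (init intended) (fun n (a : actions intended) => n = a) = X.
apply/funext => i; apply/funext => j; apply/propext; split=> [[a ->]|Xij].
  rewrite reports_intended ?ltn_add2l //= => -[i' /val_inj ->] //.
exists j => //; rewrite reports_intended ?ltn_add2l //=.
by exists i.
Qed.

End IntendedModel.
End TheSentence.

(** * Primitive recursive functions *)

Definition recursive (k : nat) (f : seq nat -> nat) : Prop :=
  exists c : recfun k, forall v : k.-tuple nat, reval c v (f v).

Lemma recursive_ext k f g : (forall s, f s = g s) -> recursive k f -> recursive k g.
Proof. by move=> fg [c Hc]; exists c => v; rewrite -fg. Qed.

Lemma recursive_nth k i : i < k -> recursive k (fun s => nth 0 s i).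
Proof.
by move=> ik; exists (RProj (Ordinal ik)) => v /=; rewrite (tnth_nth 0).
Qed.

Lemma recursive_comp k m f (gs : seq (seq nat -> nat)) : size gs = m ->
  recursive m f -> (forall i, i < m -> recursive k (nth (fun=> 0) gs i)) ->
  recursive k (fun s => f [seq g s | g <- gs]).
Proof.
move=> sz [c Hc] Hgs.
have /choice[d Hd] : forall i : 'I_m, exists d : recfun k,
    forall v : k.-tuple nat, reval d v (nth (fun=> 0) gs i v).
  by move=> i; apply: Hgs.
exists (RComp c d) => v /=.
have szv : size [seq g (tval v) | g <- gs] == m by rewrite size_map sz.
exists (Tuple szv) => [i|]; last exact: Hc (Tuple szv).
by rewrite (tnth_nth 0) /= (nth_map (fun=> 0)) ?sz.
Qed.

Lemma recursive_comp1 k F g : recursive 1 (fun s => F (nth 0 s 0)) ->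
  recursive k g -> recursive k (fun s => F (g s)).
Proof. by move=> HF Hg; apply: (recursive_comp (gs := [:: g])) HF _ => // -[]. Qed.

Lemma recursive_comp2 k F g h :
  recursive 2 (fun s => F (nth 0 s 0) (nth 0 s 1)) ->
  recursive k g -> recursive k h -> recursive k (fun s => F (g s) (h s)).
Proof.
by move=> HF Hg Hh; apply: (recursive_comp (gs := [:: g; h])) HF _ => // -[|[]].
Qed.

Lemma recursive_succ k g : recursive k g -> recursive k (fun s => (g s).+1).
Proof.
apply: (recursive_comp1 (F := S)); exists RSucc => v /=.
by rewrite /thead (tnth_nth 0).
Qed.

Lemma recursive_const k n : recursive k (fun=> n).
Proof. by elim: n => [|n]; [exists (RZero k) | apply: recursive_succ]. Qed.

Lemma recursive_prec k f g : recursive k f -> recursive k.+2 g ->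
  recursive k.+1 (fun s => nat_rect (fun=> nat) (f (behead s))
                    (fun i z => g (i :: z :: behead s)) (nth 0 s 0)).
Proof.
move=> [c Hc] [d Hd]; exists (RPrec c d) => v.
rewrite /= /thead (tnth_nth 0) /=.
set w := [tuple of behead v].
elim: (nth 0 v 0) => [|i IH] /=; first exact: (Hc w).
by exists (nat_rect (fun=> nat) (f (behead v)) (fun j z => g (j :: z :: behead v)) i);
  last exact: (Hd [tuple of i :: _ :: w]).
Qed.

Lemma recursive_rec k a (F : nat -> nat -> nat) g :
  recursive 2 (fun s => F (nth 0 s 0) (nth 0 s 1)) -> recursive k g ->
  recursive k (fun s => nat_rect (fun=> nat) a F (g s)).
Proof.
move=> HF; apply: (recursive_comp1 (F := nat_rect (fun=> nat) a F)).
exact: recursive_prec (recursive_const 0 a) HF.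
Qed.

Lemma recursive_rec_param k (F : nat -> nat -> nat) g h :
  recursive 2 (fun s => F (nth 0 s 0) (nth 0 s 1)) ->
  recursive k g -> recursive k h ->
  recursive k (fun s => nat_rect (fun=> nat) (h s) F (g s)).
Proof.
move=> HF; apply: (recursive_comp2 (F := fun n a => nat_rect (fun=> nat) a F n)).
have HF3 : recursive 3 (fun s => F (nth 0 s 0) (nth 0 s 1)).
  by apply: recursive_comp2 HF _ _; apply: recursive_nth.
apply: recursive_ext (recursive_prec (recursive_nth (ltn0Sn 0)) HF3) => s.
by rewrite nth_behead.
Qed.

Lemma recursive_add k g h : recursive k g -> recursive k h ->
  recursive k (fun s => g s + h s).
Proof.
move=> Hg Hh; have HS := recursive_succ (recursive_nth (ltnSn 1)).
apply: recursive_ext (recursive_rec_param (F := fun=> S) HS Hg Hh) => s.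
by elim: (g s) => //= n ->; rewrite addSn.
Qed.

Lemma recursive_npair k g h : recursive k g -> recursive k h ->
  recursive k (fun s => npair (g s) (h s)).
Proof.
(* [npair x y] is [y] plus the sum of the numbers up to [y + x], a primitive recursion with step
   [HF]. *)
move=> Hg Hh; have HF : recursive 2 (fun s => (nth 0 s 0).+1 + nth 0 s 1).
  by apply: recursive_add; [apply: recursive_succ|]; apply: recursive_nth.
have Hgh := recursive_add Hh Hg.
exact: recursive_ext (recursive_add Hh (recursive_rec 0 (F := fun i m => i.+1 + m) HF Hgh)).
Qed.

(** * The reduction *)

Section Chain.
Variable k : nat.
Notation AP := 'I_(7 + k).+1.
Notation Ag := 'I_4.
Notation cgs4 := (cgs AP Ag).

(** The goal of [Rel r x y y] written directly on named variables, so that its code is explicit in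
    them. *)
Definition rel_goal (r x y : nat) : sl AP Ag :=
  bind_profile (fun a : Ag => nth 0 [:: x; y; y; x] a) (Next (Atom (lab k r))).

Fixpoint chain_matrix (n : nat) : sl AP Ag :=
  if n is i.+1 then And (rel_goal 1 i i.+1) (chain_matrix i)
  else rel_goal 0 0 0.

Fixpoint chain_prefix (n : nat) : seq (bool * nat) :=
  (true, n) :: if n is i.+1 then chain_prefix i else [::].

(* The only part of the reduction that depends on the input: it makes label 5
   hold at the numeral [n]. *)
Definition chain (n : nat) : sl AP Ag :=
  quantify (chain_prefix n) (And (rel_goal 5 n n) (chain_matrix n)).

Lemma mem_chain_prefix n x : (x \in unzip2 (chain_prefix n)) = (x <= n).
Proof.
elim: n => [|n IH]; first by rewrite inE leqn0.
by rewrite /= inE IH [RHS]leq_eqVlt ltnS.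
Qed.

Lemma mem_free_rel_goal r x y w :
  (w \in sl_free (rel_goal r x y)) = (w \in [:: inr x; inr y]).
Proof.
rewrite mem_free_bind_all ?enum_uniq //= cats0.
case: w => [a|z]; first by rewrite mem_enum.
have -> : (inr z \in [seq inl i | i <- enum Ag]) = false by apply/mapP => -[].
rewrite !inE /=; apply/hasP/orP.
  case=> -[[|[|[|[|a]]]] Ha] _ //= /andP[_ /eqP->]; by [left|right|right|left].
have ag (a : Ag) : a \in enum Ag by rewrite mem_enum.
case=> /eqP[->]; [exists ord0 | exists (inord 1)] => //; apply/andP; split=> //;
  rewrite ?map_f ?ag ?inordK //.
Qed.

Lemma mem_free_chain_matrix n w :
  (w \in sl_free (chain_matrix n)) = if w is inr x then x <= n else false.
Proof.
elim: n => [|n IH]; first by rewrite mem_free_rel_goal; case: w => // x; rewrite !inE orbb leqn0.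
rewrite /= mem_cat IH mem_free_rel_goal; case: w {IH} => // x; rewrite !inE.
rewrite ![_ == inr _]/eq_op /= (leq_eqVlt x n.+1) ltnS.
by case: (eqVneq x n) => [->|]; rewrite ?leqnn ?orbT.
Qed.

Lemma bgoal_rel_goal r x y : bgoal (rel_goal r x y).
Proof. by apply: bgoal_bind (binding_prefix_profile _) _; apply/bg_next/bg_atom. Qed.

Lemma slbg_chain n : slbg (chain n).
Proof.
apply: bg_quantify.
  split=> [|x].
    elim: n => //= n IH; rewrite IH andbT -/(unzip2 _).
    by rewrite -[unzip2 _]/(unzip2 (chain_prefix n)) mem_chain_prefix ltnn.
  rewrite mem_chain_prefix /= mem_cat mem_free_chain_matrix mem_free_rel_goal !inE.
  by case: eqP => // -[->]; rewrite leqnn.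
apply: bgoal_and; first exact: bgoal_rel_goal.
elim: n => [|n IH] /=; first exact: bgoal_rel_goal.
exact: bgoal_and (bgoal_rel_goal _ _ _) IH.
Qed.

Lemma free_chain n w : w \notin sl_free (chain n).
Proof.
rewrite mem_free_quantify negb_and negbK /= mem_cat mem_free_rel_goal mem_free_chain_matrix.
case: w => [a|x]; first by rewrite orbT.
rewrite mem_map ?mem_chain_prefix; last by move=> ? ? [].
rewrite !inE orbb; case: eqP => [[->]|_]; first by rewrite leqnn.
by case: (x <= n).
Qed.

Section Semantics.
Variables (G : cgs4) (s : states G).

Lemma sat_rel_goal r x y chi (v : nat -> strategy G) :
  chi (inr x) = Some (v x) -> chi (inr y) = Some (v y) ->
  sat (rel_goal r x y) chi s <->
  reports s r (v x [:: s]) (v y [:: s]) (v y [:: s]).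
Proof.
move=> cx cy.
apply: iff_trans (sat_bind_profile (sg := fun a : Ag => v (nth 0 [:: x; y; y; x] a)) s _ _) _.
- by apply: free_agents.
- by case=> -[|[|[|[|a]]]].
apply: iff_trans (sat_next_atom _ _ _) _.
by rewrite (profE (fun i => v i [:: s])).
Qed.

Lemma sat_quantify_ex wp psi (v : nat -> strategy G) chi chi' :
  all (fun q => q.1) wp ->
  (forall x, x \in unzip2 wp -> chi' (inr x) = Some (v x)) ->
  (forall w, w \in sl_free psi -> w \notin [seq inr x | x <- unzip2 wp] ->
     chi w = chi' w) ->
  sat psi chi' s -> sat (quantify wp psi) chi s.
Proof.
elim: wp chi => [|[b x] wp IH] chi /=.
  by move=> _ _ E; apply: sat_free => w /E ->.
case/andP=> -> wpt Hv E Hpsi; exists (v x); apply: IH => // [y yw|w fw nw].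
  by apply: Hv; rewrite inE yw orbT.
rewrite /=; case: eqP => [->|/eqP wx]; first by rewrite Hv // inE eqxx.
by apply: E => //; rewrite inE negb_or wx.
Qed.

(** The second disjunct carries the variables assigned by outer quantifiers through the
    induction. *)
Lemma sat_quantify_ex_inv wp psi chi : all (fun q => q.1) wp ->
  sat (quantify wp psi) chi s ->
  exists2 chi' : assignment G, sat psi chi' s &
    forall x, x \in unzip2 wp \/ (exists st, chi (inr x) = Some st) ->
      exists st, chi' (inr x) = Some st.
Proof.
elim: wp chi => [|[b x] wp IH] chi /=.
  by move=> _ H; exists chi => // x [].
case/andP=> -> wpt [st /(IH _ wpt)[chi' H Hchi']]; exists chi' => // y Hy.
apply: Hchi'; rewrite /=; case: eqP => [_|/eqP yx]; first by right; exists st.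
case: Hy => [|[st' Hst']]; last by right; exists st'.
by rewrite inE (negbTE (_ : y != x)) => [|]; [left | apply: contraNneq yx => ->].
Qed.

Lemma chain_prefix_ex n : all (fun q => q.1) (chain_prefix n).
Proof. by elim: n. Qed.

Lemma sat_chain_matrix n chi (v : nat -> strategy G) :
  (forall i, i <= n -> chi (inr i) = Some (v i)) ->
  sat (chain_matrix n) chi s <->
  (let a i := v i [:: s] in
   reports s 0 (a 0) (a 0) (a 0) /\
   forall i, i < n -> reports s 1 (a i) (a i.+1) (a i.+1)).
Proof.
elim: n => [|n IH] Hv.
  apply: iff_trans (sat_rel_goal _ (Hv 0 _) (Hv 0 _)) _ => //.
  by split=> [|[]].
rewrite /= (propext (sat_rel_goal _ (Hv n _) (Hv n.+1 _))) //.
rewrite (propext (IH _)); last by move=> i /leqW /Hv.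
split=> [[Hn [H0 H]]|[H0 H]]; split=> //; last by split=> // i /ltnW /H.
  by move=> i; rewrite ltnS leq_eqVlt => /orP[/eqP->|/H].
exact: H.
Qed.

Lemma chain_sound n chi : sat (chain n) chi s ->
  exists2 a, numeral (reports s) n a & reports s 5 a a a.
Proof.
case/(sat_quantify_ex_inv (chain_prefix_ex n)) => chi' H Hchi'.
have [act] := action_nonempty G.
pose v i := odflt (fun=> act) (chi' (inr i)).
have Hv i : i <= n -> chi' (inr i) = Some (v i).
  rewrite -mem_chain_prefix => ni; rewrite /v.
  by have [|st ->] := Hchi' i; first left.
move: H => /= [/(sat_rel_goal _ (Hv n _) (Hv n _)) inp].
case/(sat_chain_matrix Hv) => H0 H; exists (v n [:: s]); last exact: inp.
have {Hv inp} : forall i, i <= n -> numeral (reports s) i (v i [:: s]).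
  elim=> [|i IH] //= ni; exists (v i [:: s]); last exact: H.
  exact/IH/ltnW.
exact.
Qed.

Lemma chain_complete n chi (a : nat -> actions G) :
  reports s 0 (a 0) (a 0) (a 0) ->
  (forall i, i < n -> reports s 1 (a i) (a i.+1) (a i.+1)) ->
  reports s 5 (a n) (a n) (a n) -> sat (chain n) chi s.
Proof.
move=> H0 H inp.
pose v i : strategy G := fun=> a i.
pose chi' : assignment G := fun w => if w is inr i then Some (v i) else None.
apply: (sat_quantify_ex (v := v) (chi' := chi')) => //.
- exact: chain_prefix_ex.
- move=> w fw; move: (free_chain n w); rewrite mem_free_quantify negb_and fw orbF negbK.
  by move=> ->.
split; first exact: (@sat_rel_goal 5 n n chi' v erefl erefl).2 inp.
exact: (@sat_chain_matrix n chi' v (fun _ _ => erefl)).2 (conj H0 H).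
Qed.

End Semantics.

(** * The code of the chain as a primitive recursive function *)

Definition rel_goal_code (r x y : nat) : nat :=
  npair 9 (npair 0 (npair x (npair 9 (npair 1 (npair y
  (npair 9 (npair 2 (npair y (npair 9 (npair 3 (npair x
  (npair 4 (npair 0 r))))))))))))).

Lemma sl_code_rel_goal r x y : r < 8 -> sl_code (rel_goal r x y) = rel_goal_code r x y.
Proof.
move=> r8; pose step a c := npair 9 (npair a (npair (nth 0 [:: x; y; y; x] a) c)).
have -> : sl_code (rel_goal r x y) =
    foldr step (npair 4 (npair 0 (lab k r))) [seq val a | a <- enum Ag].
  by rewrite /rel_goal /bind_profile; elim: (enum Ag) => //= a l <-.
by rewrite val_enum_ord labE // (leq_trans r8) // leq_addr.
Qed.

(** The inner recursion builds the matrix and the outer one wraps the quantifiers around it. The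
    starting value of the outer one thus depends on [n]. *)
Lemma sl_code_chain n : sl_code (chain n) =
  nat_rect (fun=> nat)
    (npair 7 (npair 0 (npair 2 (npair (rel_goal_code 5 n n)
      (nat_rect (fun=> nat) (rel_goal_code 0 0 0)
        (fun i c => npair 2 (npair (rel_goal_code 1 i i.+1) c)) n)))))
    (fun i c => npair 7 (npair i.+1 c)) n.
Proof.
have -> : nat_rect (fun=> nat) (rel_goal_code 0 0 0)
    (fun i c => npair 2 (npair (rel_goal_code 1 i i.+1) c)) n = sl_code (chain_matrix n).
  elim: n => [|n IH] /=; first by rewrite sl_code_rel_goal.
  by rewrite IH sl_code_rel_goal.
rewrite -sl_code_rel_goal // /chain.
rewrite -[npair 2 _]/(sl_code (And (rel_goal 5 n n) (chain_matrix n))).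
by move: (And _ _) => psi; elim: n => //= i ->.
Qed.

Lemma recursive_rel_goal_code j r g h : recursive j g -> recursive j h ->
  recursive j (fun s => rel_goal_code r (g s) (h s)).
Proof.
move=> Hg Hh; rewrite /rel_goal_code.
by do !apply: recursive_npair => //; apply: recursive_const.
Qed.

Lemma recursive_chain : recursive 1 (fun s => sl_code (chain (nth 0 s 0))).
Proof.
have x0 : recursive 1 (fun s => nth 0 s 0) by apply: recursive_nth.
have y0 : recursive 2 (fun s => nth 0 s 0) by apply: recursive_nth.
have y1 : recursive 2 (fun s => nth 0 s 1) by apply: recursive_nth.
have pair c i f : recursive i f -> recursive i (fun s => npair c (f s)).
  by move=> Hf; apply: recursive_npair Hf; apply: recursive_const.
apply: recursive_ext (fun s => esym (sl_code_chain (nth 0 s 0))) _.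
apply: (recursive_rec_param (F := fun i c => npair 7 (npair i.+1 c))) => //.
  by apply/pair/recursive_npair => //; apply: recursive_succ.
do 3!(apply: recursive_npair; first exact: recursive_const).
apply: recursive_npair; first exact: recursive_rel_goal_code.
apply: (recursive_rec _ (F := fun i c => npair 2 (npair (rel_goal_code 1 i i.+1) c))) => //.
apply/pair/recursive_npair => //; apply: recursive_rel_goal_code => //.
exact: recursive_succ.
Qed.

End Chain.

Section Reduction.
Variables (k : nat) (phi : aform k).
Notation base := (to_sl (@atom_goal k) atom_vars (base_fo phi)).

Definition reduction_formula (n : nat) : sl 'I_(7 + k).+1 'I_4 :=
  And base (chain k n).

Lemma slbg_reduction n : slbg (reduction_formula n).
Proof.
apply: bg_and (slbg_chain k n).
exact: (slbg_to_sl (@atom_goal_path k) (scope_base_fo phi)).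
Qed.

Lemma sentence_reduction n : sentence (reduction_formula n).
Proof.
have H w : w \notin sl_free (reduction_formula n).
  rewrite -[sl_free _]/(sl_free base ++ sl_free (chain k n)).
  rewrite mem_cat negb_or free_chain andbT.
  exact: (free_to_sl (@atom_goal_path k) (scope_base_fo phi)).
by rewrite /sentence; case E: (sl_free _) H => [|w l] // /(_ w); rewrite mem_head.
Qed.

Definition reduction (n : nat) : slbg_sentence :=
  SlbgSentence (slbg_reduction n) (sentence_reduction n).

Lemma computable_reduction : computable (fun n => slbg_code (reduction n)).
Proof.
(* Only the code of the chain varies with [n]; that of [base] enters as a constant. *)
have codeE n : slbg_code (reduction n) =
    npair (7 + k) (npair 3 (npair 2 (npair (sl_code base) (sl_code (chain k n))))).
  have codeR a b (f : sl 'I_a.+1 'I_b.+1) Hf Hs :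
      slbg_code (@SlbgSentence a b f Hf Hs) = npair a (npair b (sl_code f)) by [].
  have codeA a b (f g : sl 'I_a 'I_b) :
      sl_code (And f g) = npair 2 (npair (sl_code f) (sl_code g)) by [].
  by rewrite codeR codeA.
have [c Hc] : recursive 1 (fun s => slbg_code (reduction (nth 0 s 0))).
  apply: recursive_ext (fun s => esym (codeE (nth 0 s 0))) _.
  do 4!(apply: recursive_npair; first exact: recursive_const).
  exact: recursive_chain.
by exists c => n; exact: (Hc [tuple n]).
Qed.

(** In a model, the chain yields an action that is the numeral [n] and carries label 5, to which the
    last conjunct of [base_fo] applies. Conversely, [intended X n] is a model. *)
Lemma satisfiable_reduction n :
  satisfiable (reduction n) <->
  exists X : 'I_k -> nat -> Prop, aholds X [:: n] phi.
Proof.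
have satE := sat_to_sl (@atom_goal_path k) (@atom_semP k) (scope_base_fo phi).
split=> [[G [Hb /chain_sound[a na inp]]]|[X Hphi]].
  have [act] := action_nonempty G.
  by move/(satE G _ _ (fun _ _ => act)): Hb => /base_fo_sound; apply; eassumption.
exists (intended X n); split.
  by apply/(satE (intended X n) _ _ (fun _ _ => 0))/base_fo_complete.
(* The numbers themselves, through [id], witness the chain. *)
by apply: (@chain_complete k (intended X n) _ n _ id) => [|i _|];
  rewrite reports_intended.
Qed.

End Reduction.

Theorem theorem4p2 : sigma11_hard slbg_code satisfiable.
Proof.
move=> A [k [phi Aphi]]; exists (reduction phi); first exact: computable_reduction.
by move=> n; rewrite Aphi; apply: iff_sym; apply: satisfiable_reduction.
Qed.
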